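(* For any state $\rho$ on $\mathcal{H}_{AB}=\mathbb{C}^{d_A}\otimes\mathbb{C}^{d_B}$ define $$\mathcal{W}(\rho)=\sup\Bigl\{-\operatorname{Tr}[W\rho]\;:\;W=W^\dagger,\ \operatorname{Tr}[W\sigma]\ge0\ \ \forall\sigma\in\mathcal{SEP}(\mathcal{H}_{AB}),\ \min_{\sigma\in\mathcal{SEP}(\mathcal{H}_{AB})}\operatorname{Tr}[W\sigma]=0,\ \|W\|_{\mathrm{Lip}}\le1\Bigr\}.$$ Then $$\mathcal{W}(\rho)=\max_{\|H\|_{\mathrm{Lip}}\le1}\bigl(\operatorname{Tr}[H\rho]-\alpha(H)\bigr),$$ where the maximum is over self-adjoint $H$ on $\mathcal{H}_{AB}$ and $\alpha(H)=\max_{\sigma\in\mathcal{SEP}(\mathcal{H}_{AB})}\operatorname{Tr}[H\sigma]$; and consequently $$\mathcal{E}(\rho)\ge\mathcal{W}(\rho).$$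
   Context: Let $\mathcal{H}_A=\mathbb{C}^{d_A}$, $\mathcal{H}_B=\mathbb{C}^{d_B}$, $\mathcal{H}_{AB}=\mathcal{H}_A\otimes\mathcal{H}_B$. Write $\mathcal{D}(\mathcal{H})$ for the density operators on $\mathcal{H}$, $\mathcal{B}(\mathcal{H})$ for the operators on $\mathcal{H}$, $\|\cdot\|_{op}$ for the operator norm, and $\mathcal{SEP}(\mathcal{H}_{AB})$ for the set of separable states (convex combinations of product states $\sigma_A\otimes\sigma_B$). Fix a family $\{F_i^A\}_{i=1}^{d_A^2-1}$ of traceless Hermitian $d_A\times d_A$ matrices with $\operatorname{Tr}(F_i^AF_j^A)=\delta_{ij}$ and $\|F_i^A\|_{op}\le1$, and similarly a family $\{F_j^B\}_{j=1}^{d_B^2-1}$ for $B$. Let $\mathcal{K}_0=\{F_i^A\otimes I_B\}_i\cup\{I_A\otimes F_j^B\}_j$. On two copies $\mathcal{H}_{AB}^{(1)}\otimes\mathcal{H}_{AB}^{(2)}$ of $\mathcal{H}_{AB}$ define the cost operator $$C=\sum_{X\in\mathcal{K}_0}\bigl(X\otimes I_{AB}^{(2)}-I_{AB}^{(1)}\otimes X\bigr)^2 .$$ For $\rho,\sigma\in\mathcal{D}(\mathcal{H}_{AB})$ let $\Pi(\rho,\sigma)$ be the set of density operators on $\mathcal{H}_{AB}^{(1)}\otimes\mathcal{H}_{AB}^{(2)}$ with marginals $\rho$ and $\sigma$. The quantum Wasserstein distance of order 1 is $W_1(\rho,\sigma)=\bigl(\inf_{\tau\in\Pi(\rho,\sigma)}\operatorname{Tr}[C\tau]\bigr)^{1/2}$,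 and the Wasserstein entanglement measure is $$\mathcal{E}(\rho)=\inf_{\sigma\in\mathcal{SEP}(\mathcal{H}_{AB})}W_1(\rho,\sigma).$$ For self-adjoint $H\in\mathcal{B}(\mathcal{H}_{AB})$ the Lipschitz seminorm is $$\|H\|_{\mathrm{Lip}}=\max\Bigl\{\sup_{A\in\mathcal{B}(\mathcal{H}_A),\,\|A\|_{op}\le1}\|[A\otimes I_B,H]\|_{op},\ \sup_{B\in\mathcal{B}(\mathcal{H}_B),\,\|B\|_{op}\le1}\|[I_A\otimes B,H]\|_{op}\Bigr\}.$$ *)

(* Defs.v *)
From mathcomp Require Export all_boot all_order all_algebra.
From mathcomp Require Export sesquilinear spectral.
From mathcomp Require Export boolp classical_sets reals.
From mathcomp Require Export complex mxtens.

Set Implicit Arguments.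
Unset Strict Implicit.
Unset Printing Implicit Defensive.

Import Order.TTheory GRing.Theory Num.Theory.

#[export] Set Implicit Arguments.
#[export] Unset Strict Implicit.
#[export] Unset Printing Implicit Defensive.

Local Open Scope classical_set_scope.
Local Open Scope ring_scope.
Local Open Scope sesquilinear_scope.

(* Operators on C^n are 'M[R[i]]_n, and C^m (x) C^n is identified with C^(m * n)
   through mxtens_index, so that A (x) B is the Kronecker product A *t B.

   All suprema and infima below are those of R, which are 0 by convention on
   sets without one; as long as the dimensions are positive, each of the sets
   they are used on is nonempty and suitably bounded. *)

Definition is_max (R : realType) (S : set R) (m : R) : Prop := S m /\ ubound S m.

Definition is_min (R : realType) (S : set R) (m : R) : Prop := S m /\ lbound S m.

Section Operators.
Context {R : realType}.
Local Notation C := R[i].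

Definition vnorm n (v : 'cV[C]_n) : R :=
  Num.sqrt (\sum_(i < n) Normc.normc (v i ord0) ^+ 2).

(* The norm that MathComp-Analysis puts on matrices is the entrywise maximum,
   hence this one, induced by the Euclidean norm. *)
Definition opnorm m n (A : 'M[C]_(m, n)) : R :=
  sup [set vnorm (A *m v) | v in [set v : 'cV[C]_n | vnorm v <= 1]].

Definition commutator n (A B : 'M[C]_n) : 'M[C]_n := A *m B - B *m A.

(* In R[i], [0 <= z] means that z is real and nonnegative. *)
Definition psd n (A : 'M[C]_n) : Prop :=
  A \is hermsymmx /\ forall v : 'cV[C]_n, 0 <= (v ^t* *m A *m v) ord0 ord0.

Definition density n (A : 'M[C]_n) : Prop := psd A /\ \tr A = 1.

(* The trace of H *m A is real when both are self-adjoint. *)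
Definition expect n (H A : 'M[C]_n) : R := complex.Re (\tr (H *m A)).

(* ptrace1 traces out the first factor, ptrace2 the second one. *)
Definition ptrace1 m n (T : 'M[C]_(m * n)) : 'M[C]_n :=
  \matrix_(i, j) \sum_(k < m) T (mxtens_index (k, i)) (mxtens_index (k, j)).

Definition ptrace2 m n (T : 'M[C]_(m * n)) : 'M[C]_m :=
  \matrix_(i, j) \sum_(k < n) T (mxtens_index (i, k)) (mxtens_index (j, k)).

Definition coupling n (rho sigma : 'M[C]_n) : set 'M[C]_(n * n) :=
  [set T | [/\ density T, ptrace2 T = rho & ptrace1 T = sigma]].

Definition observable_family d (F : 'I_(d ^ 2 - 1) -> 'M[C]_d) : Prop :=
  [/\ forall i, F i \is hermsymmx,
      forall i, \tr (F i) = 0,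
      forall i j, \tr (F i *m F j) = (i == j)%:R
    & forall i, opnorm (F i) <= 1].

Section Bipartite.
Variables dA dB : nat.
Local Notation opAB := 'M[C]_(dA * dB).

Definition separable : set opAB :=
  [set sigma | exists (n : nat) (p : 'I_n -> R)
      (sA : 'I_n -> 'M[C]_dA) (sB : 'I_n -> 'M[C]_dB),
    [/\ forall k, 0 <= p k, \sum_(k < n) p k = 1,
        forall k, density (sA k) /\ density (sB k)
      & sigma = \sum_(k < n) (p k)%:C%C *: (sA k *t sB k)]].

Definition lip (H : opAB) : R :=
  Num.max
    (sup [set opnorm (commutator (A *t (1%:M : 'M[C]_dB)) H) |
           A in [set A : 'M[C]_dA | opnorm A <= 1]])
    (sup [set opnorm (commutator ((1%:M : 'M[C]_dA) *t B) H) |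
           B in [set B : 'M[C]_dB | opnorm B <= 1]]).

Definition sep_values (H : opAB) : set R :=
  [set expect H sigma | sigma in separable].

Definition alpha (H : opAB) : R := sup (sep_values H).

Definition witness : set opAB :=
  [set W | [/\ W \is hermsymmx,
               forall sigma, separable sigma -> 0 <= expect W sigma,
               is_min (sep_values W) 0
             & lip W <= 1]].

Definition wit (rho : opAB) : R := sup [set - expect W rho | W in witness].

Section Wasserstein.
Variables (FA : 'I_(dA ^ 2 - 1) -> 'M[C]_dA) (FB : 'I_(dB ^ 2 - 1) -> 'M[C]_dB).

(* The set K_0, as a list; it is duplicate-free for observable families. *)
Definition local_observables : seq opAB :=
  [seq FA i *t (1%:M : 'M[C]_dB) | i <- enum 'I_(dA ^ 2 - 1)] ++
  [seq (1%:M : 'M[C]_dA) *t FB j | j <- enum 'I_(dB ^ 2 - 1)].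

Definition cost : 'M[C]_(dA * dB * (dA * dB)) :=
  \sum_(X <- local_observables)
    (X *t (1%:M : opAB) - (1%:M : opAB) *t X) ^+ 2.

Definition wasserstein1 (rho sigma : opAB) : R :=
  Num.sqrt (inf [set expect cost T | T in coupling rho sigma]).

Definition entanglement (rho : opAB) : R :=
  inf [set wasserstein1 rho sigma | sigma in separable].

End Wasserstein.
End Bipartite.
End Operators.

(* Main.v *)
Require Import Defs.
From mathcomp Require Import functions topology normedtype derive.
From mathcomp Require Import zify ring lra.

Import Order.TTheory GRing.Theory Num.Theory.
Import numFieldNormedType.Exports.
Local Open Scope classical_set_scope.
Local Open Scope ring_scope.
Local Open Scope sesquilinear_scope.

(* For the equality, W = alpha(H) - H and H = -W exchange witnesses and
   Lipschitz functions.  The inequality follows from W(rho) <= 1 and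
   W_1 >= sqrt 2 outside the trivial case d_A = d_B = 1.

   If ||[U (x) 1, H]|| <= 1 for a unitary U on A, then conjugating rho by
   U (x) 1 changes Tr[H rho] by at most 1.  Averaging over signed shifts U
   turns rho into the product state 1/d_A (x) rho_B, so
   Tr[H rho] - alpha(H) <= 1.

   Completeness of the F_i gives sum_i F_i (x) F_i = SWAP - 1/d and
   sum_i F_i^2 = d - 1/d, hence C = 2 (d_A - S_A) + 2 (d_B - S_B), where S_A
   and S_B swap the A and B factors of the two copies.  As S_A, S_B <= 1,
   C >= 2 (d_A + d_B - 2). *)

(** The bound under conjugation rests on the identity U^* [U, H] = H - U^* H U: the trace of the
    right side against rho is the change of Tr[H rho]. The lower bound on C is an operator
    inequality, so it holds for all couplings at once and no duality between couplings and Lipschitz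
    functions enters. It is useful as soon as d_A + d_B >= 3; for d_A = d_B = 1 the cost vanishes,
    but rho is then itself a product state.

    The other difficulty is that the maxima are attained. Adding a scalar to H changes neither its
    Lipschitz seminorm nor Tr[H rho] - alpha(H), so the admissible H form an unbounded set and this
    freedom must be removed before compactness applies. Moreover alpha is itself a maximum; in place
    of its continuity, an extra real variable t is constrained by t <= Tr[H rho] - Tr[H sigma] for
    each separable sigma, which is an intersection of closed conditions. All compactness arguments
    take place in products of real lines, with the real and imaginary parts of the entries as
    coordinates. *)

Section Complex.
Context {R : realType}.
Local Notation C := R[i].
Local Notation normc := Normc.normc.
Implicit Types x y : C.

Lemma ReD x y : complex.Re (x + y) = complex.Re x + complex.Re y.
Proof. by case: x y => [a b] [c d]. Qed.

Lemma ReN x : complex.Re (- x) = - complex.Re x.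
Proof. by case: x. Qed.

Lemma Re_sum I (r : seq I) (P : pred I) (F : I -> C) :
  complex.Re (\sum_(i <- r | P i) F i) = \sum_(i <- r | P i) complex.Re (F i).
Proof. by elim/big_rec2: _ => // i a b _ <-; rewrite ReD. Qed.

Lemma ReZ (a : R) x : complex.Re (a%:C%C * x) = a * complex.Re x.
Proof. by case: x => b c /=; rewrite mul0r subr0. Qed.

Lemma Re_ge0 x : 0 <= x -> 0 <= complex.Re x.
Proof. by rewrite lecE => /andP[]. Qed.

Lemma conjCc x : x^* = x^*%C.
Proof. by []. Qed.

Lemma conjC_real (a : R) : (a%:C%C)^* = a%:C%C.
Proof. exact: conjc_real. Qed.

Lemma normcJ x : normc x^* = normc x.
Proof. by case: x => a b; rewrite conjCc /= sqrrN. Qed.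

Lemma conjC_mul_normc x : x^* * x = (normc x ^+ 2)%:C%C.
Proof.
by rewrite mulrC -normCK; case: x => a b; rewrite normc_def /= rmorphXn.
Qed.

Lemma normc_ge0 x : 0 <= normc x.
Proof. by case: x => a b; exact: sqrtr_ge0. Qed.

Lemma sqr_normc x : normc x ^+ 2 = complex.Re x ^+ 2 + complex.Im x ^+ 2.
Proof. by case: x => a b /=; rewrite sqr_sqrtr // addr_ge0 ?sqr_ge0. Qed.

Lemma normcB x y : normc (x - y) <= normc x + normc y.
Proof. by rewrite -(normcN y) le_normcD. Qed.

Lemma normc_sum I (r : seq I) (P : pred I) (F : I -> C) :
  normc (\sum_(i <- r | P i) F i) <= \sum_(i <- r | P i) normc (F i).
Proof.
elim/big_ind2: _ => // [|a b c d h k]; first by rewrite Normc.normc0.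
exact: le_trans (le_normcD _ _) (lerD h k).
Qed.

End Complex.

(** * Conjugate transposes and Kronecker products *)

Section Adjoint.
Context {R : realType}.
Local Notation C := R[i].

Lemma adjE m n (A : 'M[C]_(m, n)) i j : A^t* i j = (A j i)^*.
Proof. by rewrite !mxE. Qed.

Lemma adjM m n p (A : 'M[C]_(m, n)) (B : 'M[C]_(n, p)) :
  (A *m B)^t* = B^t* *m A^t*.
Proof. by rewrite trmx_mul map_mxM. Qed.

Lemma adjD m n (A B : 'M[C]_(m, n)) : (A + B)^t* = A^t* + B^t*.
Proof. by rewrite linearD /= map_mxD. Qed.

Lemma adjN m n (A : 'M[C]_(m, n)) : (- A)^t* = - A^t*.
Proof. by rewrite linearN /= map_mxN. Qed.

Lemma adj_real_scale m n (a : R) (A : 'M[C]_(m, n)) :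
  (a%:C%C *: A)^t* = a%:C%C *: A^t*.
Proof. by apply/matrixP => i j; rewrite !mxE rmorphM /= conjC_real. Qed.

Lemma adj1 n : (1%:M : 'M[C]_n)^t* = 1%:M.
Proof. by rewrite trmx1 map_mx1. Qed.

Lemma adj_tens m n p q (A : 'M[C]_(m, n)) (B : 'M[C]_(p, q)) :
  (A *t B)^t* = A^t* *t B^t*.
Proof. by rewrite trmx_tens map_mxT. Qed.

Lemma hermsymmxE n (A : 'M[C]_n) : (A \is hermsymmx) = (A^t* == A).
Proof. by rewrite is_hermitianmxE expr0 scale1r eq_sym. Qed.

Lemma sum_mxtens (V : nmodType) m n (F : 'I_(m * n) -> V) :
  \sum_x F x = \sum_i \sum_j F (mxtens_index (i, j)).
Proof.
rewrite pair_big /= (reindex (@mxtens_index m n)) /=.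
  by apply: eq_bigr => -[].
by exists (@mxtens_unindex m n) => x _; rewrite (mxtens_indexK, mxtens_unindexK).
Qed.

Lemma mxtens_index_eq m n (i j : 'I_m) (k l : 'I_n) :
  (mxtens_index (i, k) == mxtens_index (j, l)) = (i == j) && (k == l).
Proof. by rewrite (can_eq (@mxtens_indexK m n)). Qed.

Lemma tr_tens m n (A : 'M[C]_m) (B : 'M[C]_n) : \tr (A *t B) = \tr A * \tr B.
Proof.
rewrite /mxtrace sum_mxtens mulr_suml; apply: eq_bigr => i _.
by rewrite mulr_sumr; apply: eq_bigr => j _; rewrite tensmxE.
Qed.

Lemma tens1mx1 m n : (1%:M : 'M[C]_m) *t (1%:M : 'M[C]_n) = 1%:M.
Proof.
apply/matrixP => x y; case: x / (mxtens_indexP x) => i k.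
case: y / (mxtens_indexP y) => j l.
by rewrite tensmxE !mxE mxtens_index_eq -natrM mulnb.
Qed.

Lemma tensZl m n p q (a : C) (A : 'M[C]_(m, n)) (B : 'M[C]_(p, q)) :
  (a *: A) *t B = a *: (A *t B).
Proof. by apply/matrixP => x y; rewrite !mxE mulrA. Qed.

Lemma tensZr m n p q (a : C) (A : 'M[C]_(m, n)) (B : 'M[C]_(p, q)) :
  A *t (a *: B) = a *: (A *t B).
Proof. by apply/matrixP => x y; rewrite !mxE mulrCA. Qed.

Lemma tens_scalar_mx1 m n (a : C) :
  (a%:M : 'M[C]_m) *t (1%:M : 'M[C]_n) = a%:M.
Proof. by rewrite -(scalemx1 m) tensZl tens1mx1 scalemx1. Qed.

Lemma tens_1scalar_mx m n (a : C) :
  (1%:M : 'M[C]_m) *t (a%:M : 'M[C]_n) = a%:M.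
Proof. by rewrite -(scalemx1 n) tensZr tens1mx1 scalemx1. Qed.

Lemma tensDr m n p q (A : 'M[C]_(m, n)) (B D : 'M[C]_(p, q)) :
  A *t (B + D) = A *t B + A *t D.
Proof. by apply/matrixP => x y; rewrite !mxE mulrDr. Qed.

Lemma tensDl m n p q (A B : 'M[C]_(m, n)) (D : 'M[C]_(p, q)) :
  (A + B) *t D = A *t D + B *t D.
Proof. by apply/matrixP => x y; rewrite !mxE mulrDl. Qed.

End Adjoint.

(** * Positive matrices, densities and partial traces *)

Section Psd.
Context {R : realType}.
Local Notation C := R[i].

Lemma psd_gram m n (X : 'M[C]_(m, n)) : psd (X^t* *m X).
Proof.
split; first by rewrite hermsymmxE adjM trmxCK.
move=> v; rewrite mulmxA -mulmxA -adjM mxE.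
by apply: sumr_ge0 => i _; rewrite adjE mulrC mul_conjC_ge0.
Qed.

Lemma psd_diag n (A : 'M[C]_n) i : psd A -> 0 <= A i i.
Proof.
case=> _ /(_ (delta_mx i ord0)).
rewrite -colE 2!mxE (bigD1 i) //= big1 ?addr0 => [|j ji].
  by rewrite !mxE !eqxx /= conjC1 mul1r.
by rewrite !mxE (negPf ji) /= conjC0 mul0r.
Qed.

Lemma psd_trace n (A : 'M[C]_n) : psd A -> 0 <= \tr A.
Proof. by move=> pA; apply: sumr_ge0 => i _; exact: psd_diag. Qed.

(** Diagonalise by the spectral theorem and take square roots of the eigenvalues. The Gram form
    reduces congruences, tensor products and traces of products of positive matrices to
    [psd_gram]. *)
Lemma psd_factor n (A : 'M[C]_n) : psd A -> exists X : 'M[C]_n, A = X^t* *m X.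
Proof.
move=> pA; have hA := hermitian_normalmx pA.1.
set P := spectralmx A; set d := spectral_diag A.
have UP : P \is unitarymx := spectral_unitarymx A.
have eA : A = P^t* *m diag_mx d *m P.
  by rewrite -(invmx_unitary UP); exact: (elimT (@orthomx_spectralP _ _ A) hA).
have eD : diag_mx d = P *m A *m P^t*.
  rewrite [in RHS]eA !mulmxA (unitarymxP UP) mul1mx -mulmxA (unitarymxP UP).
  by rewrite mulmx1.
have d0 i : 0 <= d ord0 i.
  have : 0 <= diag_mx d i i.
    apply: psd_diag; rewrite eD; split.
      have /eqP hA' : A^t* == A by rewrite -hermsymmxE pA.1.
      by rewrite hermsymmxE; apply/eqP; rewrite !adjM trmxCK hA' mulmxA.
    move=> v; have := pA.2 (P^t* *m v).
    by rewrite adjM trmxCK !mulmxA.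
  by rewrite mxE eqxx mulr1n.
pose S : 'M[C]_n := diag_mx (\row_i sqrtC (d ord0 i)).
have SS : S^t* *m S = diag_mx d.
  apply/matrixP => i j; rewrite !mxE (bigD1 i) //= big1 ?addr0 => [|k ki].
    rewrite !mxE eqxx mulr1n; case: eqVneq => [_|_]; last by rewrite !mulr0n mulr0.
    by rewrite !mulr1n conj_Creal ?sqrtC_real // -expr2 sqrtCK.
  by rewrite !mxE (negPf ki) mulr0n conjC0 mul0r.
by exists (S *m P); rewrite adjM mulmxA -(mulmxA (P^t*) (S^t*) S) SS.
Qed.

Lemma psd_congr m n (A : 'M[C]_n) (Y : 'M[C]_(n, m)) :
  psd A -> psd (Y^t* *m A *m Y).
Proof.
by move=> /psd_factor[X ->]; rewrite mulmxA -mulmxA -adjM; exact: psd_gram.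
Qed.

Lemma psd0 n : psd (0 : 'M[C]_n).
Proof. by have := psd_gram (0 : 'M[C]_n); by rewrite mulmx0. Qed.

Lemma psdD n (A B : 'M[C]_n) : psd A -> psd B -> psd (A + B).
Proof.
move=> [hA pA] [hB pB]; split.
  by move: hA hB; rewrite !hermsymmxE adjD => /eqP -> /eqP ->.
by move=> v; rewrite mulmxDr mulmxDl mxE addr_ge0.
Qed.

Lemma psd_sum n I (r : seq I) (F : I -> 'M[C]_n) :
  (forall i, psd (F i)) -> psd (\sum_(i <- r) F i).
Proof. move=> pF; apply: (big_ind (@psd R n)); [exact: psd0|exact: psdD|by []]. Qed.

Lemma psdZ n (a : R) (A : 'M[C]_n) : 0 <= a -> psd A -> psd (a%:C%C *: A).
Proof.
move=> a0 [hA pA]; split.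
  by move: hA; rewrite !hermsymmxE adj_real_scale => /eqP ->.
by move=> v; rewrite -scalemxAr -scalemxAl mxE mulr_ge0 // ler0c.
Qed.

Lemma psd_tens m n (A : 'M[C]_m) (B : 'M[C]_n) : psd A -> psd B -> psd (A *t B).
Proof.
move=> /psd_factor[X ->] /psd_factor[Y ->].
by rewrite -tensmx_mul -adj_tens; exact: psd_gram.
Qed.

Lemma density_tens m n (A : 'M[C]_m) (B : 'M[C]_n) :
  density A -> density B -> density (A *t B).
Proof.
by move=> [pA tA] [pB tB]; split; [exact: psd_tens|rewrite tr_tens tA tB mulr1].
Qed.

Lemma ptrace1_tens m n (A : 'M[C]_m) (B : 'M[C]_n) : ptrace1 (A *t B) = \tr A *: B.
Proof.
apply/matrixP => i j; rewrite !mxE mulr_suml.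
by apply: eq_bigr => k _; rewrite tensmxE.
Qed.

Lemma ptrace2_tens m n (A : 'M[C]_m) (B : 'M[C]_n) : ptrace2 (A *t B) = \tr B *: A.
Proof.
apply/matrixP => i j; rewrite !mxE mulr_suml.
by apply: eq_bigr => k _; rewrite tensmxE mulrC.
Qed.

Lemma tr_ptrace1 m n (T : 'M[C]_(m * n)) : \tr (ptrace1 T) = \tr T.
Proof.
rewrite /mxtrace sum_mxtens exchange_big /=.
by apply: eq_bigr => i _; rewrite mxE.
Qed.

Lemma psd_ptrace1 m n (T : 'M[C]_(m * n)) : psd T -> psd (ptrace1 T).
Proof.
(* [Y k] is the isometry that tensors with the [k]-th basis vector of the first factor; the partial
   trace is a sum of congruences by these (its Kraus form). *)
move=> pT; pose Y k : 'M[C]_(m * n, n) :=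
  \matrix_(x, j) (x == mxtens_index (k, j))%:R.
have YE p k (M : 'M[C]_(p, m * n)) i j : (M *m Y k) i j = M i (mxtens_index (k, j)).
  rewrite mxE (bigD1 (mxtens_index (k, j))) //= big1 ?addr0 => [|x xk].
    by rewrite mxE eqxx mulr1.
  by rewrite mxE (negPf xk) mulr0.
have -> : ptrace1 T = \sum_k (Y k)^t* *m T *m Y k.
  apply/matrixP => i j; rewrite mxE summxE; apply: eq_bigr => k _.
  rewrite YE; rewrite -[in RHS](trmxCK T) -adjM adjE YE adjE conjCK //.
by apply: psd_sum => k; exact: psd_congr.
Qed.

Lemma density_ptrace1 m n (T : 'M[C]_(m * n)) : density T -> density (ptrace1 T).
Proof. by move=> [pT tT]; split; [exact: psd_ptrace1|rewrite tr_ptrace1]. Qed.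

Lemma density_gt0 n (A : 'M[C]_n) : density A -> (0 < n)%N.
Proof.
case: n A => // A [_ /eqP]; rewrite /mxtrace big_ord0 => /eqP/esym/eqP.
by rewrite oner_eq0.
Qed.

Lemma density_mixed n : (0 < n)%N -> density ((n%:R^-1 : R)%:C%C *: (1%:M : 'M[C]_n)).
Proof.
move=> n0; split.
  apply: psdZ; first by rewrite invr_ge0 ler0n.
  by rewrite -[1%:M](mulmx1) -[X in X *m _]adj1; exact: psd_gram.
rewrite mxtraceZ mxtrace1 -(rmorph_nat (real_complex R)) -rmorphM /=.
by rewrite mulVf ?pnatr_eq0 -?lt0n.
Qed.

End Psd.

(** * Expectation values *)

Section Expect.
Context {R : realType}.
Local Notation C := R[i].

Lemma expectDl n (H K A : 'M[C]_n) : expect (H + K) A = expect H A + expect K A.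
Proof. by rewrite /expect mulmxDl mxtraceD ReD. Qed.

Lemma expectNl n (H A : 'M[C]_n) : expect (- H) A = - expect H A.
Proof. by rewrite /expect mulNmx -scaleN1r mxtraceZ mulN1r ReN. Qed.

Lemma expectZl n (a : R) (H A : 'M[C]_n) :
  expect (a%:C%C *: H) A = a * expect H A.
Proof. by rewrite /expect -scalemxAl mxtraceZ ReZ. Qed.

Lemma expectZr n (a : R) (H A : 'M[C]_n) :
  expect H (a%:C%C *: A) = a * expect H A.
Proof. by rewrite /expect -scalemxAr mxtraceZ ReZ. Qed.

Lemma expect_sumr n I (r : seq I) (H : 'M[C]_n) (F : I -> 'M[C]_n) :
  expect H (\sum_(i <- r) F i) = \sum_(i <- r) expect H (F i).
Proof.
apply: (big_morph (expect H)) => [A B|]; last by rewrite /expect mulmx0 mxtrace0.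
by rewrite /expect mulmxDr mxtraceD ReD.
Qed.

Lemma expect_scalar n (a : R) (A : 'M[C]_n) : \tr A = 1 -> expect (a%:C%C)%:M A = a.
Proof. by move=> tA; rewrite /expect mul_scalar_mx mxtraceZ tA mulr1. Qed.

Lemma expect_psd_ge0 n (H A : 'M[C]_n) : psd H -> psd A -> 0 <= expect H A.
Proof.
move=> /psd_factor[X ->] pA; apply: Re_ge0.
rewrite -mulmxA mxtrace_mulC -mulmxA.
have := psd_trace (psd_congr (X^t*) pA).
by rewrite trmxCK mulmxA.
Qed.

End Expect.

(** * Euclidean and operator norms *)

Section Norms.
Context {R : realType}.
Local Notation C := R[i].
Local Notation normc := Normc.normc.

Lemma vnorm_ge0 n (v : 'cV[C]_n) : 0 <= vnorm v.
Proof. exact: sqrtr_ge0. Qed.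

Lemma sqr_vnorm n (v : 'cV[C]_n) : vnorm v ^+ 2 = \sum_i normc (v i ord0) ^+ 2.
Proof. by rewrite sqr_sqrtr // sumr_ge0 // => i _; exact: sqr_ge0. Qed.

Lemma gram_vnorm n (v : 'cV[C]_n) :
  (v^t* *m v) ord0 ord0 = (vnorm v ^+ 2)%:C%C.
Proof.
rewrite mxE sqr_vnorm rmorph_sum; apply: eq_bigr => i _.
by rewrite adjE conjC_mul_normc.
Qed.

Lemma vnorm_isometry m n (U : 'M[C]_(m, n)) (v : 'cV[C]_n) :
  U^t* *m U = 1%:M -> vnorm (U *m v) = vnorm v.
Proof.
move=> UU; apply/eqP; rewrite -(eqrXn2 (n := 2)) ?vnorm_ge0 //; apply/eqP.
apply: (@complexI R); rewrite -!gram_vnorm adjM mulmxA -(mulmxA _ (U^t*)) UU.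
by rewrite mulmx1.
Qed.

Lemma vnorm0 n : vnorm (0 : 'cV[C]_n) = 0.
Proof.
by rewrite /vnorm big1 ?sqrtr0 // => i _; rewrite mxE Normc.normc0 expr0n.
Qed.

Lemma vnormN n (v : 'cV[C]_n) : vnorm (- v) = vnorm v.
Proof. by congr Num.sqrt; apply: eq_bigr => i _; rewrite mxE normcN. Qed.

Lemma vnormZ n (a : R) (v : 'cV[C]_n) : 0 <= a -> vnorm (a%:C%C *: v) = a * vnorm v.
Proof.
move=> a0; apply/eqP; rewrite -(eqrXn2 (n := 2)) ?mulr_ge0 ?vnorm_ge0 //.
rewrite exprMn !sqr_vnorm mulr_sumr; apply/eqP; apply: eq_bigr => i _.
by rewrite mxE Normc.normcM exprMn [X in X * _]sqr_normc /= expr0n addr0.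
Qed.

Lemma normc_le_vnorm n (v : 'cV[C]_n) i : normc (v i ord0) <= vnorm v.
Proof.
rewrite -(ger0_norm (normc_ge0 _)) -sqrtr_sqr ler_sqrt ?sumr_ge0 // => [|j _]; last exact: sqr_ge0.
by rewrite (bigD1 i) //= lerDl sumr_ge0 // => j _; exact: sqr_ge0.
Qed.

Lemma vnorm_eq0 n (v : 'cV[C]_n) : vnorm v = 0 -> v = 0.
Proof.
move=> v0; apply/matrixP => i j; rewrite mxE ord1; apply: Normc.eq0_normc.
by apply/eqP; rewrite eq_le normc_ge0 -v0 normc_le_vnorm.
Qed.

Lemma vnorm_le_sum n (v : 'cV[C]_n) : vnorm v <= \sum_i normc (v i ord0).
Proof.
have s0 : 0 <= \sum_i normc (v i ord0) by apply: sumr_ge0 => i _; exact: normc_ge0.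
rewrite -[leRHS]ger0_norm // -sqrtr_sqr ler_sqrt ?sqr_ge0 //.
rewrite expr2 mulr_suml; apply: ler_sum => i _.
rewrite expr2 ler_wpM2l ?normc_ge0 // (bigD1 i) //= lerDl.
by apply: sumr_ge0 => j _; exact: normc_ge0.
Qed.

(** A crude bound, which makes the sets behind [opnorm] and [lip] bounded, so that their [sup] is a
    true least upper bound and not the default 0. *)
Lemma vnorm_mulmx_le_sum m n (A : 'M[C]_(m, n)) (v : 'cV[C]_n) :
  vnorm v <= 1 -> vnorm (A *m v) <= \sum_i \sum_j normc (A i j).
Proof.
move=> v1; apply: (le_trans (vnorm_le_sum _)); apply: ler_sum => i _.
rewrite mxE; apply: (le_trans (normc_sum _ _ _)); apply: ler_sum => j _.
rewrite Normc.normcM -[leRHS]mulr1 ler_wpM2l ?normc_ge0 //.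
exact: le_trans (normc_le_vnorm _ _) v1.
Qed.

Lemma opnorm_le m n (A : 'M[C]_(m, n)) (c : R) :
  (forall v, vnorm v <= 1 -> vnorm (A *m v) <= c) -> opnorm A <= c.
Proof.
move=> h; apply: ge_sup; last by move=> _ [v v1 <-]; exact: h.
by exists (vnorm (A *m 0)); exists 0; rewrite //= vnorm0.
Qed.

Lemma le_opnorm m n (A : 'M[C]_(m, n)) (v : 'cV[C]_n) :
  vnorm v <= 1 -> vnorm (A *m v) <= opnorm A.
Proof.
move=> v1; apply: ub_le_sup; last by exists v.
by exists (\sum_i \sum_j normc (A i j)) => _ [w w1 <-]; exact: vnorm_mulmx_le_sum.
Qed.

Lemma opnorm_le_sum m n (A : 'M[C]_(m, n)) : opnorm A <= \sum_i \sum_j normc (A i j).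
Proof. by apply: opnorm_le => v; exact: vnorm_mulmx_le_sum. Qed.

Lemma opnormP m n (A : 'M[C]_(m, n)) (c : R) :
  opnorm A <= c <-> forall v, vnorm v <= 1 -> vnorm (A *m v) <= c.
Proof.
split=> [Ac v v1|]; last exact: opnorm_le.
exact: le_trans (le_opnorm A v1) Ac.
Qed.

Lemma opnorm_le1_contracts m n (A : 'M[C]_(m, n)) (v : 'cV[C]_n) :
  opnorm A <= 1 -> vnorm (A *m v) <= vnorm v.
Proof.
move=> /opnormP A1; have [v0|v0] := eqVneq (vnorm v) 0.
  by rewrite (vnorm_eq0 v0) mulmx0 !vnorm0.
have v_gt0 : 0 < vnorm v by rewrite lt_neqAle eq_sym v0 vnorm_ge0.
have := A1 ((vnorm v)^-1%:C%C *: v).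
rewrite -scalemxAr !vnormZ ?invr_ge0 ?vnorm_ge0 // mulVf // lexx => /(_ isT).
by rewrite mulrC ler_pdivrMr // mul1r.
Qed.

Lemma opnorm_isometry m n (U : 'M[C]_(m, n)) : U^t* *m U = 1%:M -> opnorm U <= 1.
Proof. by move=> UU; apply: opnorm_le => v; rewrite vnorm_isometry. Qed.

Lemma vnorm_delta n (j : 'I_n) : vnorm (delta_mx j ord0 : 'cV[C]_n) = 1.
Proof.
rewrite /vnorm (bigD1 j) //= big1 ?addr0 => [|i ij].
  by rewrite mxE !eqxx Normc.normc1 expr1n sqrtr1.
by rewrite mxE (negPf ij) Normc.normc0 expr0n.
Qed.

Lemma normc_le_opnorm m n (A : 'M[C]_(m, n)) i j : normc (A i j) <= opnorm A.
Proof.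
have -> : A i j = (A *m (delta_mx j ord0 : 'cV_n)) i ord0 by rewrite -(colE j A) mxE.
apply: (le_trans (normc_le_vnorm _ _)); apply: le_opnorm.
by rewrite vnorm_delta.
Qed.

Lemma opnorm_delta m n (a : 'I_m) (b : 'I_n) : opnorm (delta_mx a b : 'M[C]_(m, n)) <= 1.
Proof.
apply: opnorm_le => v v1.
have -> : delta_mx a b *m v = v b ord0 *: delta_mx a ord0.
  apply/matrixP => i j; rewrite !mxE ord1 eqxx andbT (bigD1 b) //= big1 ?addr0 => [|k kb].
    by rewrite mxE eqxx andbT mulrC.
  by rewrite mxE (negPf kb) andbF mul0r.
rewrite /vnorm (bigD1 a) //= big1 ?addr0 => [|i ia]; last first.
  by rewrite !mxE (negPf ia) mulr0 Normc.normc0 expr0n.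
rewrite !mxE !eqxx mulr1 sqrtr_sqr ger0_norm ?normc_ge0 //.
exact: le_trans (normc_le_vnorm _ _) v1.
Qed.

(** The arithmetic-geometric form of Cauchy-Schwarz, sufficient where both norms have the same
    bound. *)
Lemma Re_inner_le n (u v : 'cV[C]_n) :
  complex.Re ((u^t* *m v) ord0 ord0) <= (vnorm u ^+ 2 + vnorm v ^+ 2) / 2.
Proof.
rewrite mxE Re_sum !sqr_vnorm -big_split /= mulr_suml.
apply: ler_sum => i _; rewrite adjE conjCc !sqr_normc.
case: (u i ord0) (v i ord0) => [a b] [c d] /=.
have := sqr_ge0 (a - c); have := sqr_ge0 (b - d); nra.
Qed.

End Norms.

(** * The Lipschitz seminorm and its consequences *)

Section Lipschitz.
Context {R : realType}.
Local Notation C := R[i].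
Local Notation normc := Normc.normc.

Lemma normc_commutator_le n (X H : 'M[C]_n) i j :
  (forall i j, normc (X i j) <= 1) ->
  normc (commutator X H i j) <= \sum_k normc (H k j) + \sum_k normc (H i k).
Proof.
move=> X1; rewrite /commutator !mxE; apply: (le_trans (normcB _ _)).
apply: lerD; apply: (le_trans (normc_sum _ _ _)); apply: ler_sum => k _.
  by rewrite Normc.normcM -[leRHS]mul1r ler_wpM2r ?normc_ge0.
by rewrite Normc.normcM -[leRHS]mulr1 ler_wpM2l ?normc_ge0.
Qed.

(** The hypothesis on [f] makes the set bounded; on an unbounded set [sup] is 0 and would say
    nothing about single operators. *)
Lemma sup_commutator_leP d n (f : 'M[C]_d -> 'M[C]_n) (H : 'M[C]_n) (c : R) :
  (forall A, opnorm A <= 1 -> forall i j, normc (f A i j) <= 1) ->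
  sup [set opnorm (commutator (f A) H) | A in [set A | opnorm A <= 1]] <= c <->
  forall A, opnorm A <= 1 -> opnorm (commutator (f A) H) <= c.
Proof.
move=> f1; split=> [supc A A1|h].
  apply: le_trans supc; apply: ub_le_sup; last by exists A.
  exists (\sum_i \sum_j (\sum_k normc (H k j) + \sum_k normc (H i k))).
  move=> _ [B B1 <-]; apply: (le_trans (opnorm_le_sum _)).
  apply: ler_sum => i _; apply: ler_sum => j _.
  by apply: normc_commutator_le; exact: f1.
apply: ge_sup; last by move=> _ [A A1 <-]; exact: h.
exists (opnorm (commutator (f 0) H)); exists 0 => //=.
by apply: opnorm_le => v _; rewrite mul0mx vnorm0.
Qed.

Lemma normc_bool (b : bool) : normc (b%:R : C) <= 1.
Proof. by case: b; rewrite ?Normc.normc0 ?Normc.normc1. Qed.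

Lemma normc_tens_le1 m n p q (A : 'M[C]_(m, n)) (B : 'M[C]_(p, q)) i j :
  (forall i j, normc (A i j) <= 1) -> (forall i j, normc (B i j) <= 1) ->
  normc ((A *t B) i j) <= 1.
Proof.
move=> A1 B1; case: i / (mxtens_indexP i) => i k.
case: j / (mxtens_indexP j) => j l.
by rewrite tensmxE Normc.normcM mulr_ile1 ?normc_ge0.
Qed.

Lemma lip_leP dA dB (H : 'M[C]_(dA * dB)) (c : R) :
  lip H <= c <->
  (forall A : 'M[C]_dA, opnorm A <= 1 ->
     opnorm (commutator (A *t (1%:M : 'M[C]_dB)) H) <= c) /\
  (forall B : 'M[C]_dB, opnorm B <= 1 ->
     opnorm (commutator ((1%:M : 'M[C]_dA) *t B) H) <= c).
Proof.
have id1 d (i j : 'I_d) : normc ((1%:M : 'M[C]_d) i j) <= 1.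
  by rewrite mxE; exact: normc_bool.
rewrite /lip ge_max; split=> [/andP[hA hB]|[hA hB]]; [split|apply/andP; split].
- apply/(sup_commutator_leP (f := fun A => A *t 1%:M)) => // A A1 i j.
  by apply: normc_tens_le1 => // k l; exact: le_trans (normc_le_opnorm _ _ _) A1.
- apply/(sup_commutator_leP (f := fun B => 1%:M *t B)) => // A A1 i j.
  by apply: normc_tens_le1 => // k l; exact: le_trans (normc_le_opnorm _ _ _) A1.
- apply/(sup_commutator_leP (f := fun A => A *t 1%:M)) => // A A1 i j.
  by apply: normc_tens_le1 => // k l; exact: le_trans (normc_le_opnorm _ _ _) A1.
- apply/(sup_commutator_leP (f := fun B => 1%:M *t B)) => // A A1 i j.
  by apply: normc_tens_le1 => // k l; exact: le_trans (normc_le_opnorm _ _ _) A1.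
Qed.

Lemma commutator_scalarB n (a : C) (X H : 'M[C]_n) :
  commutator X (a%:M - H) = - commutator X H.
Proof.
rewrite /commutator mulmxBr mulmxBl mul_mx_scalar mul_scalar_mx opprB.
by rewrite opprB addrC addrA subrK.
Qed.

Lemma opnormN m n (A : 'M[C]_(m, n)) : opnorm (- A) = opnorm A.
Proof.
by apply/eqP; rewrite eq_le; apply/andP; split; apply: opnorm_le => v v1;
  [rewrite mulNmx vnormN|rewrite -vnormN -mulNmx]; exact: le_opnorm.
Qed.

(** Commutators ignore scalars. The case [a = 0] is invariance under negation, and two applications
    give a shift by a scalar. *)
Lemma lip_scalarB dA dB (a : C) (H : 'M[C]_(dA * dB)) (c : R) :
  lip H <= c -> lip (a%:M - H) <= c.
Proof.
move=> /lip_leP[hA hB]; apply/lip_leP.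
by split=> [A|B] ?; rewrite commutator_scalarB opnormN; auto.
Qed.

(** In the row [a] of the matrix unit, the commutator compares the block [(b, j)] of [H] with the
    diagonal block at [a], which survives only for [j = b]. *)
Lemma commutator_unit_l dA dB (H : 'M[C]_(dA * dB)) (a b j : 'I_dA) (k l : 'I_dB) :
  commutator (delta_mx a b *t (1%:M : 'M[C]_dB)) H
    (mxtens_index (a, k)) (mxtens_index (j, l)) =
  H (mxtens_index (b, k)) (mxtens_index (j, l)) -
  (j == b)%:R * H (mxtens_index (a, k)) (mxtens_index (a, l)).
Proof.
rewrite /commutator !mxE; congr (_ - _).
  rewrite (bigD1 (mxtens_index (b, k))) //= big1 ?addr0 => [|x].
    by rewrite tensmxE !mxE !eqxx !mul1r.
  case: x / (mxtens_indexP x) => i m; rewrite mxtens_index_eq tensmxE !mxE eqxx /=.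
  by rewrite (eq_sym k); case: eqP => //=; case: eqP => //=; rewrite ?mulr0 ?mul0r.
rewrite (bigD1 (mxtens_index (a, l))) //= big1 ?addr0 => [|x].
  by rewrite tensmxE !mxE !eqxx /= mulr1 mulrC.
case: x / (mxtens_indexP x) => i m; rewrite mxtens_index_eq tensmxE !mxE.
by case: eqP => //=; case: eqP => //=; rewrite ?mulr0 ?mul0r ?mulr0.
Qed.

Lemma commutator_unit_r dA dB (H : 'M[C]_(dA * dB)) (i j : 'I_dA) (a b l : 'I_dB) :
  commutator ((1%:M : 'M[C]_dA) *t delta_mx a b) H
    (mxtens_index (i, a)) (mxtens_index (j, l)) =
  H (mxtens_index (i, b)) (mxtens_index (j, l)) -
  (l == b)%:R * H (mxtens_index (i, a)) (mxtens_index (j, a)).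
Proof.
rewrite /commutator !mxE; congr (_ - _).
  rewrite (bigD1 (mxtens_index (i, b))) //= big1 ?addr0 => [|x].
    by rewrite tensmxE !mxE !eqxx !mul1r.
  case: x / (mxtens_indexP x) => k m; rewrite mxtens_index_eq tensmxE !mxE eqxx /=.
  by rewrite (eq_sym i); case: eqP => //=; case: eqP => //=; rewrite ?mulr0 ?mul0r.
rewrite (bigD1 (mxtens_index (j, a))) //= big1 ?addr0 => [|x].
  by rewrite tensmxE !mxE !eqxx /= mul1r mulrC.
case: x / (mxtens_indexP x) => k m; rewrite mxtens_index_eq tensmxE !mxE.
by case: eqP => //=; case: eqP => //=; rewrite ?mulr0 ?mul0r ?mulr0.
Qed.

(** Matrix units serve as test operators: one on the first factor moves the block to [a0], one on
    the second moves the entry to [k0], each at cost 1, whence 2. Up to a scalar, Lipschitz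
    operators are thus bounded. *)
Lemma lip_entry_bound dA dB (H : 'M[C]_(dA * dB)) x0 x y :
  lip H <= 1 -> normc (H x y - (x == y)%:R * H x0 x0) <= 2.
Proof.
move=> /lip_leP[hA hB].
case: x0 / (mxtens_indexP x0) => a0 k0; case: x / (mxtens_indexP x) => b k.
case: y / (mxtens_indexP y) => j l; rewrite mxtens_index_eq.
have hl : normc (H (mxtens_index (b, k)) (mxtens_index (j, l)) -
    (j == b)%:R * H (mxtens_index (a0, k)) (mxtens_index (a0, l))) <= 1.
  rewrite -commutator_unit_l; apply: (le_trans (normc_le_opnorm _ _ _)).
  by apply: hA; exact: opnorm_delta.
have hr : normc (H (mxtens_index (a0, k)) (mxtens_index (a0, l)) -
    (l == k)%:R * H (mxtens_index (a0, k0)) (mxtens_index (a0, k0))) <= 1.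
  rewrite -commutator_unit_r; apply: (le_trans (normc_le_opnorm _ _ _)).
  by apply: hB; exact: opnorm_delta.
move: hl; rewrite eq_sym; case: eqVneq => [_|_] /=; rewrite ?mul1r ?mul0r => hl.
  have := lerD hl hr => /(le_trans (le_normcD _ _)).
  by rewrite addrA subrK [l == k]eq_sym.
by apply: (le_trans hl); rewrite ler1n.
Qed.

(** Write [rho] as the sum of the rank-one matrices [x r *m (x r)^t*]. The difference is the sum of
    the real parts of the inner products of [V *m x r] with [K *m x r]. Each is at most the squared
    norm of [x r], and these squares add up to the trace of [rho]. *)
Lemma isometry_transport_cost n (H V rho : 'M[C]_n) :
  density rho -> V^t* *m V = 1%:M -> opnorm (commutator V H) <= 1 ->
  expect H rho - expect H (V *m rho *m V^t*) <= 1.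
Proof.
move=> [/psd_factor[X ->] trho] VV K1.
pose K := commutator V H; pose x r := col r (X^t*).
have -> : expect H (X^t* *m X) = \sum_r complex.Re ((X *m H *m X^t*) r r).
  by rewrite /expect mulmxA mxtrace_mulC mulmxA Re_sum.
have -> : expect H (V *m (X^t* *m X) *m V^t*) =
    \sum_r complex.Re ((X *m (V^t* *m H *m V) *m X^t*) r r).
  rewrite /expect !mulmxA mxtrace_mulC !mulmxA mxtrace_mulC !mulmxA -Re_sum.
  by rewrite /mxtrace.
have nx : \sum_r vnorm (x r) ^+ 2 = 1.
  transitivity (complex.Re (\tr (X^t* *m X))); last by rewrite trho.
  rewrite mxtrace_mulC /mxtrace Re_sum; apply: eq_bigr => r _.
  rewrite -[LHS]/(complex.Re (vnorm (x r) ^+ 2)%:C%C) -gram_vnorm !mxE.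
  by congr complex.Re; apply: eq_bigr => k _; rewrite !mxE conjCK.
rewrite -sumrB -nx; apply: ler_sum => r _; rewrite -ReN -ReD.
have -> : (X *m H *m X^t*) r r - (X *m (V^t* *m H *m V) *m X^t*) r r =
    ((V *m x r)^t* *m (K *m x r)) ord0 ord0.
  have -> : (V *m x r)^t* *m (K *m x r) = (x r)^t* *m (H - V^t* *m H *m V) *m x r.
    have VK : V^t* *m K = H - V^t* *m H *m V.
      by rewrite /K /commutator mulmxBr !mulmxA VV mul1mx.
    by rewrite adjM -(mulmxA _ (V^t*)) (mulmxA (V^t*)) VK mulmxA.
  have -> : (X *m H *m X^t*) r r - (X *m (V^t* *m H *m V) *m X^t*) r r =
      (X *m (H - V^t* *m H *m V) *m X^t*) r r.
    by rewrite mulmxBr mulmxBl [in RHS]mxE [X in _ = _ + X]mxE.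
  have -> : (x r)^t* = row r X by apply/matrixP => i j; rewrite !mxE conjCK.
  rewrite -row_mul [LHS]mxE [RHS]mxE; apply: eq_bigr => k _.
  by congr (_ * _); rewrite [RHS]mxE.
apply: (le_trans (Re_inner_le _ _)); rewrite ler_pdivrMr // mulr_natr mulr2n.
rewrite (vnorm_isometry _ VV) lerD2l lerXn2r ?nnegrE ?vnorm_ge0 //.
exact: opnorm_le1_contracts.
Qed.

End Lipschitz.

(** * Averaging over signed shifts *)

Section Twirl.
Context {R : realType}.
Local Notation C := R[i].

Lemma sum_signs d (i j : 'I_d) :
  \sum_(e : {ffun 'I_d -> bool}) (-1) ^+ e i * (-1) ^+ e j =
  ((i == j)%:R * 2 ^+ d : C).
Proof.
case: eqVneq => [<-|ij].
  rewrite mul1r (eq_bigr (fun=> 1)) => [|e _]; last first.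
    by rewrite -expr2 sqrr_sign.
  by rewrite sumr_const card_ffun card_bool card_ord natrX.
rewrite mul0r; set S := LHS.
(* Flipping the sign at [i] alone negates every term, so the sum equals its opposite. *)
pose flip (e : {ffun 'I_d -> bool}) := [ffun k => (k == i) (+) e k].
have flipK : involutive flip by move=> e; apply/ffunP => k; rewrite !ffunE addbA addbb.
have : S = - S.
  rewrite {1}/S (reindex_inj (inv_inj flipK)) /= -sumrN; apply: eq_bigr => e _.
  by rewrite !ffunE eqxx eq_sym (negPf ij) /= signrN mulNr.
by move/eqP; rewrite -addr_eq0 -mulr2n mulrn_eq0 /= => /eqP.
Qed.

(** Diagonal signs times a cyclic shift, a real substitute for the Weyl operators. The dimension is
    a successor so that ordinals carry modular addition. *)
Definition signed_shift d (e : {ffun 'I_d.+1 -> bool}) (c : 'I_d.+1) : 'M[C]_d.+1 :=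
  \matrix_(i, j) ((-1) ^+ e i * (i == j + c)%:R).

Lemma signed_shift_isometry d (e : {ffun 'I_d.+1 -> bool}) c :
  (signed_shift e c)^t* *m signed_shift e c = 1%:M.
Proof.
apply/matrixP => j j'; rewrite mxE (bigD1 (j + c)) //= big1 ?addr0 => [|i ij].
  rewrite adjE !mxE eqxx mulr1 rmorph_sign mulrA -expr2 sqrr_sign mul1r.
  by rewrite (inj_eq (addIr c)).
by rewrite adjE !mxE (negPf ij) mulr0 conjC0 mul0r.
Qed.

Lemma signed_shift_conj d n (e : {ffun 'I_d.+1 -> bool}) c
    (T : 'M[C]_(d.+1 * n)) i j k l :
  let V := signed_shift e c *t (1%:M : 'M[C]_n) in
  (V *m T *m V^t*) (mxtens_index (i, k)) (mxtens_index (j, l)) =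
  (-1) ^+ e i * (-1) ^+ e j *
  T (mxtens_index (i - c, k)) (mxtens_index (j - c, l)).
Proof.
move=> V.
have VE p (M : 'M[C]_(d.+1 * n, p)) i' k' y : (V *m M) (mxtens_index (i', k')) y =
    (-1) ^+ e i' * M (mxtens_index (i' - c, k')) y.
  rewrite mxE (bigD1 (mxtens_index (i' - c, k'))) //= big1 ?addr0 => [|x].
    by rewrite tensmxE !mxE subrK !eqxx !mulr1.
  case: x / (mxtens_indexP x) => a b; rewrite mxtens_index_eq tensmxE !mxE.
  rewrite -(subr_eq i') (eq_sym a) (eq_sym b).
  by case: eqP => //=; case: eqP => //=; rewrite ?mulr0 ?mul0r.
(* Taking adjoints turns the factor on the right into [V] on the left, so [VE] handles both
   sides. *)
rewrite -[V *m T *m V^t*]trmxCK adjE adjM trmxCK VE adjE VE.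
by rewrite rmorphM /= conjCK rmorph_sign mulrCA mulrA.
Qed.

(** The signs remove the off-diagonal blocks and yield the factor [2 ^+ d.+1]; the sum over shifts
    adds up the diagonal blocks into [ptrace1 T]. *)
Lemma twirl d n (T : 'M[C]_(d.+1 * n)) :
  \sum_(e : {ffun 'I_d.+1 -> bool}) \sum_(c : 'I_d.+1)
    ((signed_shift e c *t (1%:M : 'M[C]_n)) *m T *m
     (signed_shift e c *t (1%:M : 'M[C]_n))^t*) =
  (2 ^+ d.+1 : R)%:C%C *: (1%:M *t ptrace1 T).
Proof.
apply/matrixP => x y; case: x / (mxtens_indexP x) => i k.
case: y / (mxtens_indexP y) => j l.
rewrite [RHS]mxE tensmxE [1%:M i j]mxE [ptrace1 T k l]mxE summxE.
transitivity (\sum_(e : {ffun 'I_d.+1 -> bool}) (((-1) ^+ e i * (-1) ^+ e j : C) *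
    \sum_(c : 'I_d.+1) T (mxtens_index (i - c, k)) (mxtens_index (j - c, l)))).
  apply: eq_bigr => e _; rewrite summxE mulr_sumr; apply: eq_bigr => c _.
  exact: signed_shift_conj.
have pow2C : (2 ^+ d.+1 : C) = (2 ^+ d.+1 : R)%:C%C by rewrite rmorphXn rmorph_nat.
rewrite -mulr_suml sum_signs pow2C.
case: eqVneq => [<-|_]; last by rewrite !mul0r mulr0.
rewrite !mul1r; congr (_ * _); have inv_sub : involutive (fun c => i - c).
  by move=> c; rewrite opprB addrC subrK.
by rewrite (reindex_inj (inv_inj inv_sub)); apply: eq_bigr => c _; rewrite inv_sub.
Qed.

Lemma twirl_cost dA dB (H rho : 'M[C]_(dA * dB)) :
  density rho -> lip H <= 1 ->
  expect H rho -
    expect H (((dA%:R^-1 : R)%:C%C *: (1%:M : 'M[C]_dA)) *t ptrace1 rho) <= 1.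
Proof.
move=> drho /lip_leP[hA _].
have := density_gt0 drho; rewrite muln_gt0 => /andP[+ _].
case: dA H rho drho hA => // d H rho drho hA _.
pose V (e : {ffun 'I_d.+1 -> bool}) c := signed_shift e c *t (1%:M : 'M[C]_dB).
have V1 e c : expect H rho - expect H (V e c *m rho *m (V e c)^t*) <= 1.
  apply: isometry_transport_cost => //.
    by rewrite /V adj_tens tensmx_mul signed_shift_isometry adj1 mulmx1 tens1mx1.
  by apply: hA; exact/opnorm_isometry/signed_shift_isometry.
have : \sum_(e : {ffun 'I_d.+1 -> bool}) \sum_(c : 'I_d.+1)
    (expect H rho - expect H (V e c *m rho *m (V e c)^t*)) <=
    \sum_(e : {ffun 'I_d.+1 -> bool}) \sum_(c : 'I_d.+1) 1.
  by apply: ler_sum => e _; apply: ler_sum => c _; exact: V1.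
under eq_bigr => e _ do rewrite sumrB.
rewrite sumrB.
have -> : \sum_(e : {ffun 'I_d.+1 -> bool}) \sum_(c : 'I_d.+1)
    expect H (V e c *m rho *m (V e c)^t*) =
    2 ^+ d.+1 * expect H (1%:M *t ptrace1 rho).
  rewrite -expectZr -twirl expect_sumr; apply: eq_bigr => e _.
  by rewrite expect_sumr.
rewrite !sumr_const card_ffun card_bool card_ord.
rewrite tensZl expectZr; set x := expect H rho; set y := expect H _.
rewrite -!mulrnA -(mulr_natl x) natrM natrX.
have a0 : 0 < 2 ^+ d.+1 :> R by rewrite exprn_gt0.
have d0 : 0 < d.+1%:R :> R by rewrite ltr0n.
rewrite [_%:R * _]mulrC -mulrA -mulrBr ler_pM2l // => h.
by rewrite -(ler_pM2l d0) mulrBr mulrA mulfV ?gt_eqF // mul1r mulr1.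
Qed.

End Twirl.

(** * Completeness of the observables and the lower bound on the cost *)

Section Cost.
Context {R : realType}.
Local Notation C := R[i].

(** For [mulmx1C] between sizes, such as [d ^ 2 - 1 + 1] and [d * d], that are equal only by a
    proof. *)
Lemma mulmx1C_eq m n (A : 'M[C]_(m, n)) (B : 'M[C]_(n, m)) :
  m = n -> A *m B = 1%:M -> B *m A = 1%:M.
Proof. by move=> e; case: n / e A B => A B; exact: mulmx1C. Qed.

(* The F_i together with the identity form a basis of the matrix space, whose
   dual basis for the trace form is again the F_i together with 1/d. *)
Lemma observable_completeness d (F : 'I_(d ^ 2 - 1) -> 'M[C]_d) (a b c e : 'I_d) :
  observable_family F ->
  \sum_i F i a b * F i c e =
  (a == e)%:R * (b == c)%:R - (a == b)%:R * (c == e)%:R * d%:R^-1.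
Proof.
case=> _ trF trFF _.
have d0 : (0 < d)%N by case: (d) a => // -[].
have dC : d%:R != 0 :> C by rewrite pnatr_eq0 -lt0n.
pose G : 'M[C]_(d ^ 2 - 1 + 1, d * d) := col_mx
  (\matrix_(i, x) F i (mxtens_unindex x).1 (mxtens_unindex x).2)
  (\row_x ((mxtens_unindex x).1 == (mxtens_unindex x).2)%:R).
pose G' : 'M[C]_(d * d, d ^ 2 - 1 + 1) := row_mx
  (\matrix_(x, i) F i (mxtens_unindex x).2 (mxtens_unindex x).1)
  (\col_x (((mxtens_unindex x).1 == (mxtens_unindex x).2)%:R * d%:R^-1)).
have tr_eq (A : 'M[C]_d) : \sum_i \sum_j A i j * (i == j)%:R = \tr A.
  apply: eq_bigr => i _; rewrite (bigD1 i) //= big1 ?addr0 ?eqxx ?mulr1 // => j ji.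
  by rewrite eq_sym (negPf ji) mulr0.
have GG : G *m G' = 1%:M.
  rewrite mul_col_row scalar_mx_block; congr block_mx.
  - apply/matrixP => i j; rewrite !mxE -trFF /mxtrace sum_mxtens.
    apply: eq_bigr => k _; rewrite mxE; apply: eq_bigr => l _.
    by rewrite !mxE mxtens_indexK.
  - apply/matrixP => i j; rewrite !mxE sum_mxtens.
    transitivity (\tr (F i) * d%:R^-1); last by rewrite trF mul0r.
    rewrite -tr_eq mulr_suml; apply: eq_bigr => k _; rewrite mulr_suml; apply: eq_bigr => l _.
    by rewrite !mxE mxtens_indexK /= mulrA.
  - apply/matrixP => i j; rewrite !mxE sum_mxtens exchange_big.
    transitivity (\tr (F j)); last by rewrite trF.
    rewrite -tr_eq; apply: eq_bigr => k _; apply: eq_bigr => l _.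
    by rewrite !mxE mxtens_indexK /= mulrC eq_sym.
  - apply/matrixP => i j; rewrite !ord1 !mxE sum_mxtens eqxx.
    transitivity (\tr (1%:M : 'M[C]_d) * d%:R^-1); last by rewrite mxtrace1 mulfV.
    rewrite -tr_eq mulr_suml; apply: eq_bigr => k _; rewrite mulr_suml; apply: eq_bigr => l _.
    by rewrite !mxE mxtens_indexK /= mulrA.
(* The size of the family enters here: [G] is square, so orthonormality, [G *m G' = 1], gives
   completeness, [G' *m G = 1]. The truncated subtraction is harmless as [d] is positive. *)
have eqd : (d ^ 2 - 1 + 1 = d * d)%N by rewrite subnK ?mulnn // expn_gt0 d0.
have := mulmx1C_eq eqd GG; rewrite mul_row_col.
(* The first pair is reversed because [G'] stores the transposes of the [F i]. *)
move/matrixP/(_ (mxtens_index (b, a)) (mxtens_index (c, e))).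
rewrite !mxE mxtens_index_eq big_ord1 !mxE !mxtens_indexK.
under eq_bigr => i _ do rewrite !mxE !mxtens_indexK.
move=> /=.
move/eqP; rewrite -[_ == _]subr_eq0 -addrA addr_eq0 => /eqP ->.
by rewrite opprB -mulnb natrM [in RHS]mulrC mulrAC (eq_sym b a).
Qed.

Lemma sum_sqr_observables d (F : 'I_(d ^ 2 - 1) -> 'M[C]_d) :
  observable_family F -> \sum_i F i *m F i = (d%:R - d%:R^-1)%:M.
Proof.
move=> hF; apply/matrixP => a e; rewrite summxE.
under eq_bigr => i _ do rewrite mxE.
rewrite exchange_big /=.
under eq_bigr => b _ do rewrite (observable_completeness _ _ _ _ hF) eqxx mulr1.
rewrite sumrB sumr_const card_ord mxE (bigD1 a) //= big1 ?addr0 => [|b ba].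
  by rewrite eqxx mul1r; case: (a == e); rewrite ?mul1r ?mul0r ?mulr0n ?mul0rn ?subr0.
by rewrite eq_sym (negPf ba) !mul0r.
Qed.

Definition involution_mx n (f : 'I_n -> 'I_n) : 'M[C]_n :=
  \matrix_(x, y) (x == f y)%:R.

(** The permutation matrix [S] is self-adjoint and squares to 1, so [1 - S] is twice a projection,
    hence half of its own Gram matrix. *)
Lemma psd_1B_involution n (f : 'I_n -> 'I_n) :
  involutive f -> psd (1%:M - involution_mx f).
Proof.
move=> fK; set S := involution_mx f.
have S2 : S *m S = 1%:M.
  apply/matrixP => x y; rewrite mxE (bigD1 (f y)) //= big1 ?addr0 => [|z zy].
    by rewrite !mxE eqxx mulr1 fK.
  by rewrite !mxE (negPf zy) mulr0.
have Sa : S^t* = S.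
  by apply/matrixP => x y; rewrite adjE !mxE (eq_sym y) (inv_eq fK); case: eqP => _ /=;
    rewrite ?conjC1 ?conjC0.
have -> : 1%:M - S = (2^-1 : R)%:C%C *: ((1%:M - S)^t* *m (1%:M - S)).
  rewrite adjD adjN adj1 Sa mulmxBr !mulmxBl !mul1mx !mulmx1 S2.
  rewrite -[X in _ *: (_ - X)]opprB opprK scalerDr -scalerDl -rmorphD /=.
  by rewrite (_ : 2^-1 + 2^-1 = 1) ?scale1r //; lra.
by apply: psdZ; [rewrite invr_ge0|exact: psd_gram].
Qed.

Lemma sqr_tensB n (X : 'M[C]_n) :
  (X *t (1%:M : 'M[C]_n) - (1%:M : 'M[C]_n) *t X) ^+ 2 =
  (X *m X) *t (1%:M : 'M[C]_n) + (1%:M : 'M[C]_n) *t (X *m X) - (X *t X) *+ 2.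
Proof.
rewrite expr2 -[LHS]/(_ *m _) mulmxBr !mulmxBl !tensmx_mul !mul1mx !mulmx1.
by rewrite mulr2n opprB opprD addrACA.
Qed.

(** Here [d] is the dimension of one party, [n] that of a whole copy, and [f] swaps that party
    between the copies. Expanding the squares, the terms in [1/d] cancel and the sum is
    [2 (d - 1) + 2 (1 - S)], with [S] the matrix of [f]. *)
Lemma expect_sum_sqr_tensB n d I (r : seq I) (X : I -> 'M[C]_n) f (T : 'M[C]_(n * n)) :
  (0 < d)%N -> density T -> involutive f ->
  \sum_(i <- r) X i *m X i = (d%:R - d%:R^-1)%:M ->
  \sum_(i <- r) X i *t X i = involution_mx f - (d%:R^-1)%:M ->
  2 * (d%:R - 1) <= expect
    (\sum_(i <- r) (X i *t (1%:M : 'M[C]_n) - (1%:M : 'M[C]_n) *t X i) ^+ 2) T.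
Proof.
move=> d0 [pT tT] fK sq sw.
have sumtl (F : I -> 'M[C]_n) (B : 'M[C]_n) :
    \sum_(i <- r) F i *t B = (\sum_(i <- r) F i) *t B.
  by elim/big_rec2: _ => [|i A D _ ->]; rewrite ?tens0mx ?tensDl.
have sumtr (F : I -> 'M[C]_n) (B : 'M[C]_n) :
    \sum_(i <- r) B *t F i = B *t (\sum_(i <- r) F i).
  elim/big_rec2: _ => [|i A D _ ->]; rewrite ?tensmx0 //.
  by rewrite tensDr.
have -> : \sum_(i <- r) (X i *t (1%:M : 'M[C]_n) - (1%:M : 'M[C]_n) *t X i) ^+ 2 =
    ((2 * (d%:R - 1) : R)%:C%C)%:M + (2 : R)%:C%C *: (1%:M - involution_mx f).
  under eq_bigr => i _ do rewrite sqr_tensB.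
  rewrite sumrB big_split /= sumtl sumtr sumrMnl sq sw.
  rewrite tens_scalar_mx1 tens_1scalar_mx.
  have dC : (d%:R - 1 : R)%:C%C = d%:R - 1 by rewrite rmorphB rmorph1 rmorph_nat.
  rewrite rmorphM /= dC (rmorph_nat (real_complex R) 2).
  apply/matrixP => x y; rewrite !mxE mulr2n.
  by case: (x == y); rewrite ?mulr1n ?mulr0n; ring.
rewrite expectDl expect_scalar // expectZl lerDl mulr_ge0 //.
by apply: expect_psd_ge0; [exact: psd_1B_involution|exact: pT].
Qed.

Section Bipartite.
Variables dA dB : nat.

Definition swapA (x : 'I_(dA * dB * (dA * dB))) : 'I_(dA * dB * (dA * dB)) :=
  let u := mxtens_unindex x in
  let p := mxtens_unindex u.1 in let q := mxtens_unindex u.2 in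
  mxtens_index (mxtens_index (q.1, p.2), mxtens_index (p.1, q.2)).

Definition swapB (x : 'I_(dA * dB * (dA * dB))) : 'I_(dA * dB * (dA * dB)) :=
  let u := mxtens_unindex x in
  let p := mxtens_unindex u.1 in let q := mxtens_unindex u.2 in
  mxtens_index (mxtens_index (p.1, q.2), mxtens_index (q.1, p.2)).

Lemma swapAK : involutive swapA.
Proof.
move=> x; case: x / (mxtens_indexP x) => u v; case: u / (mxtens_indexP u) => a b.
by case: v / (mxtens_indexP v) => c e; rewrite /swapA !mxtens_indexK.
Qed.

Lemma swapBK : involutive swapB.
Proof.
move=> x; case: x / (mxtens_indexP x) => u v; case: u / (mxtens_indexP u) => a b.
by case: v / (mxtens_indexP v) => c e; rewrite /swapB !mxtens_indexK.
Qed.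

Lemma sum_tens_observablesA (F : 'I_(dA ^ 2 - 1) -> 'M[C]_dA) :
  observable_family F ->
  \sum_i (F i *t (1%:M : 'M[C]_dB)) *t (F i *t (1%:M : 'M[C]_dB)) =
  involution_mx swapA - (dA%:R^-1)%:M.
Proof.
move=> hF; apply/matrixP => x y; rewrite summxE.
case: x / (mxtens_indexP x) => u v; case: u / (mxtens_indexP u) => a b.
case: v / (mxtens_indexP v) => a' b'.
case: y / (mxtens_indexP y) => u v; case: u / (mxtens_indexP u) => c e.
case: v / (mxtens_indexP v) => c' e'.
under eq_bigr => i _ do rewrite !tensmxE mulrACA.
rewrite -mulr_suml (observable_completeness _ _ _ _ hF) !mxE /swapA !mxtens_indexK /=.
rewrite !mxtens_index_eq (eq_sym a' c).
by case: (a == c'); case: (c == a'); case: (a == c); case: (a' == c');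
  case: (b == e); case: (b' == e'); rewrite /= ?mulr1n ?mulr0n; ring.
Qed.

Lemma sum_tens_observablesB (F : 'I_(dB ^ 2 - 1) -> 'M[C]_dB) :
  observable_family F ->
  \sum_i ((1%:M : 'M[C]_dA) *t F i) *t ((1%:M : 'M[C]_dA) *t F i) =
  involution_mx swapB - (dB%:R^-1)%:M.
Proof.
move=> hF; apply/matrixP => x y; rewrite summxE.
case: x / (mxtens_indexP x) => u v; case: u / (mxtens_indexP u) => a b.
case: v / (mxtens_indexP v) => a' b'.
case: y / (mxtens_indexP y) => u v; case: u / (mxtens_indexP u) => c e.
case: v / (mxtens_indexP v) => c' e'.
under eq_bigr => i _ do rewrite !tensmxE mulrACA.
rewrite -mulr_sumr (observable_completeness _ _ _ _ hF) !mxE /swapB !mxtens_indexK /=.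
rewrite !mxtens_index_eq (eq_sym b' e).
by case: (b == e'); case: (e == b'); case: (a == c); case: (a' == c');
  case: (b == e); case: (b' == e'); rewrite /= ?mulr1n ?mulr0n; ring.
Qed.

Lemma expect_cost_ge (FA : 'I_(dA ^ 2 - 1) -> 'M[C]_dA)
    (FB : 'I_(dB ^ 2 - 1) -> 'M[C]_dB) T :
  observable_family FA -> observable_family FB -> density T ->
  2 * (dA%:R - 1) + 2 * (dB%:R - 1) <= expect (cost FA FB) T.
Proof.
move=> hA hB dT; have := density_gt0 dT; rewrite !muln_gt0 andbb => /andP[dA0 dB0].
rewrite /cost /local_observables big_cat !big_map -!enumT !big_enum /= expectDl lerD //.
  apply: (expect_sum_sqr_tensB _ dT swapAK) => //.
    transitivity ((\sum_i FA i *m FA i) *t (1%:M : 'M[C]_dB)).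
      apply: (big_rec2 (fun A B => A = B *t _)); first by rewrite tens0mx.
      by move=> i A D _ ->; rewrite tensmx_mul mulmx1 tensDl.
    by rewrite sum_sqr_observables // tens_scalar_mx1.
  exact: sum_tens_observablesA.
apply: (expect_sum_sqr_tensB _ dT swapBK) => //.
  transitivity ((1%:M : 'M[C]_dA) *t (\sum_i FB i *m FB i)).
    apply: (big_rec2 (fun A B => A = _ *t B)); first by rewrite tensmx0.
    by move=> i A D _ ->; rewrite tensmx_mul mulmx1 tensDr.
  by rewrite sum_sqr_observables // tens_1scalar_mx.
exact: sum_tens_observablesB.
Qed.

End Bipartite.
End Cost.

(** * Compactness and closed conditions in products of real lines *)

Section Continuity.
Context {R : realType} {I : eqType}.
Local Notation C := R[i].
Local Notation normc := Normc.normc.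
Local Notation X := (prod_topology (fun _ : I => R)).

(** [D] is a closed subset of a box, which is compact by Tychonoff's theorem. *)
Lemma compact_max_exists (D : set X) (f : X -> R) (M : R) :
  D !=set0 -> closed D -> (forall x, D x -> forall i, `|x i| <= M) ->
  continuous f -> exists2 c, D c & forall x, D x -> f x <= f c.
Proof.
move=> D0 cD bD cf.
have kD : compact D.
  pose box := [set x : X | forall i, `[- M, M]%classic (x i)].
  apply: (@subclosed_compact _ _ box) => //; last first.
    by move=> x Dx i; rewrite /= in_itv /= -ler_norml; exact: bD.
  by apply: (@tychonoff I (fun=> R) (fun=> `[- M, M]%classic)) => i; exact: segment_compact.
have [c cD' h] := compact_EVT_max D0 kD (continuous_subspaceT cf).
by exists c => [|x Dx]; [exact: set_mem|exact/h/mem_set].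
Qed.

Lemma eq_continuous (f g : X -> R) : f =1 g -> continuous f -> continuous g.
Proof. by move=> /funext ->. Qed.

Lemma continuous_add (f g : X -> R) :
  continuous f -> continuous g -> continuous (fun x => f x + g x).
Proof. by move=> cf cg x; exact: (cvgD (cf x) (cg x)). Qed.

Lemma continuous_sub (f g : X -> R) :
  continuous f -> continuous g -> continuous (fun x => f x - g x).
Proof. by move=> cf cg x; exact: (cvgB (cf x) (cg x)). Qed.

Lemma continuous_mul (f g : X -> R) :
  continuous f -> continuous g -> continuous (fun x => f x * g x).
Proof. by move=> cf cg x; exact: (cvgM (cf x) (cg x)). Qed.

Lemma continuous_opp (f : X -> R) : continuous f -> continuous (fun x => - f x).
Proof. by move=> cf x; exact: (cvgN (cf x)). Qed.

Lemma continuous_const (c : R) : continuous (fun _ : X => c).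
Proof. exact: (@cst_continuous X R c). Qed.

(** Stated through real and imaginary parts, so that only the topology of [R] is involved. *)
Definition ccontinuous (f : X -> C) : Prop :=
  continuous (fun x => complex.Re (f x)) /\ continuous (fun x => complex.Im (f x)).

Lemma eq_ccontinuous (f g : X -> C) : f =1 g -> ccontinuous f -> ccontinuous g.
Proof. by move=> /funext ->. Qed.

Lemma ccontinuous_cst (z : C) : ccontinuous (fun=> z).
Proof. by split; exact: continuous_const. Qed.

Lemma ccontinuousD f g :
  ccontinuous f -> ccontinuous g -> ccontinuous (fun x => f x + g x).
Proof.
move=> [fr fi] [gr gi]; split.
  apply: eq_continuous (continuous_add fr gr) => x.
  by case: (f x) (g x) => [? ?] [? ?].
apply: eq_continuous (continuous_add fi gi) => x.
by case: (f x) (g x) => [? ?] [? ?].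
Qed.

Lemma ccontinuousM f g :
  ccontinuous f -> ccontinuous g -> ccontinuous (fun x => f x * g x).
Proof.
move=> [fr fi] [gr gi]; split.
  apply: eq_continuous (continuous_sub (continuous_mul fr gr) (continuous_mul fi gi)) => x.
  by case: (f x) (g x) => [? ?] [? ?].
apply: eq_continuous (continuous_add (continuous_mul fr gi) (continuous_mul fi gr)) => x.
by case: (f x) (g x) => [? ?] [? ?].
Qed.

Lemma ccontinuousJ f : ccontinuous f -> ccontinuous (fun x => (f x)^*).
Proof.
move=> [fr fi]; split.
  by apply: eq_continuous fr => x; case: (f x).
by apply: eq_continuous (continuous_opp fi) => x; case: (f x).
Qed.

Lemma ccontinuous_sum J (r : seq J) (F : J -> X -> C) :
  (forall j, ccontinuous (F j)) -> ccontinuous (fun x => \sum_(j <- r) F j x).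
Proof.
move=> cF; elim: r => [|j r IH].
  by apply: eq_ccontinuous (ccontinuous_cst 0) => x; rewrite big_nil.
by apply: eq_ccontinuous (ccontinuousD (cF j) IH) => x; rewrite big_cons.
Qed.

Lemma closed_le_continuous (f g : X -> R) :
  continuous f -> continuous g -> closed [set x | f x <= g x].
Proof.
move=> cf cg.
have -> : [set x | f x <= g x] = (fun x => g x - f x) @^-1` [set y | 0 <= y].
  by apply/seteqP; split=> x /=; rewrite subr_ge0.
apply: preimage_closed; last exact: closed_ge.
by move=> x _; exact: (continuous_sub cg cf).
Qed.

Lemma closed_ccontinuous_eq0 f : ccontinuous f -> closed [set x | f x = 0].
Proof.
move=> [fr fi].
have -> : [set x | f x = 0] = (fun x => complex.Re (f x)) @^-1` [set y | y = 0] `&`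
    (fun x => complex.Im (f x)) @^-1` [set y | y = 0].
  by apply/seteqP; split=> x /=; case: (f x) => a b /=; [case=> -> ->|case=> -> ->].
apply: closedI; apply: preimage_closed; try exact: closed_eq.
  by move=> x _; exact: fr.
by move=> x _; exact: fi.
Qed.

Lemma closed_ccontinuous_ge0 f : ccontinuous f -> closed [set x | 0 <= f x].
Proof.
move=> [fr fi].
have -> : [set x | 0 <= f x] = (fun x => complex.Im (f x)) @^-1` [set y | y = 0] `&`
    (fun x => complex.Re (f x)) @^-1` [set y | 0 <= y].
  apply/seteqP; split=> x /=; first by rewrite lecE => /andP[/eqP].
  by rewrite lecE => -[-> ->]; rewrite eqxx.
apply: closedI; apply: preimage_closed; [|exact: closed_eq| |exact: closed_ge].
  by move=> x _; exact: fi.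
by move=> x _; exact: fr.
Qed.

Lemma closed_forall J (P : J -> X -> Prop) :
  (forall j, closed [set x | P j x]) -> closed [set x | forall j, P j x].
Proof.
move=> cP; have -> : [set x | forall j, P j x] = \bigcap_j [set x | P j x].
  by apply/seteqP; split=> x h j; [move=> _; exact: h|exact: (h j Logic.I)].
by apply: closed_bigI => j _; exact: cP.
Qed.

Lemma closed_imply (Q : Prop) (P : X -> Prop) :
  (Q -> closed [set x | P x]) -> closed [set x | Q -> P x].
Proof.
move=> cP; have [q|nq] := pselect Q.
  have -> : [set x | Q -> P x] = [set x | P x]
    by apply/seteqP; split=> x h; [exact: h|move=> _; exact: h].
  exact: cP.
have -> : [set x | Q -> P x] = setT by apply/seteqP; split=> x // _ /nq.
exact: closedT.
Qed.

Definition mcontinuous m n (A : X -> 'M[C]_(m, n)) : Prop :=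
  forall i j, ccontinuous (fun x => A x i j).

Lemma mcontinuous_cst m n (A : 'M[C]_(m, n)) : mcontinuous (fun=> A).
Proof. by move=> i j; exact: ccontinuous_cst. Qed.

Lemma mcontinuousM m n p (A : X -> 'M[C]_(m, n)) (B : X -> 'M[C]_(n, p)) :
  mcontinuous A -> mcontinuous B -> mcontinuous (fun x => A x *m B x).
Proof.
move=> cA cB i j.
apply: eq_ccontinuous (ccontinuous_sum (index_enum _)
  (fun k => ccontinuousM (cA i k) (cB k j))) => x.
by rewrite mxE.
Qed.

Lemma mcontinuousB m n (A B : X -> 'M[C]_(m, n)) :
  mcontinuous A -> mcontinuous B -> mcontinuous (fun x => A x - B x).
Proof.
move=> cA cB i j.
apply: eq_ccontinuous (ccontinuousD (cA i j)
  (ccontinuousM (ccontinuous_cst (-1)) (cB i j))) => x.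
by rewrite !mxE mulN1r.
Qed.

Lemma mcontinuous_tens m n p q (A : X -> 'M[C]_(m, n)) (B : X -> 'M[C]_(p, q)) :
  mcontinuous A -> mcontinuous B -> mcontinuous (fun x => A x *t B x).
Proof.
move=> cA cB i j; apply: eq_ccontinuous (ccontinuousM (cA _ _) (cB _ _)) => x.
by rewrite mxE.
Qed.

Lemma continuous_expect n (A B : X -> 'M[C]_n) :
  mcontinuous A -> mcontinuous B -> continuous (fun x => expect (A x) (B x)).
Proof.
move=> cA cB; have := mcontinuousM cA cB => cAB.
by have [] := ccontinuous_sum (index_enum _) (fun i => cAB i i).
Qed.

Lemma continuous_sqr_vnorm n (v : X -> 'cV[C]_n) :
  mcontinuous v -> continuous (fun x => vnorm (v x) ^+ 2).
Proof.
move=> cv; have cc : ccontinuous (fun x => \sum_i (v x i ord0)^* * v x i ord0).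
  apply: ccontinuous_sum => i; apply: ccontinuousM; last exact: cv.
  exact/ccontinuousJ/cv.
have [h _] := cc; have -> // : (fun x => vnorm (v x) ^+ 2) =
  (fun x => complex.Re (\sum_i (v x i ord0)^* * v x i ord0)).
apply/funext => x; rewrite sqr_vnorm Re_sum; apply: eq_bigr => i _.
by rewrite conjC_mul_normc.
Qed.

Lemma closed_hermsymmx n (A : X -> 'M[C]_n) :
  mcontinuous A -> closed [set x | A x \is hermsymmx].
Proof.
move=> cA.
have -> : [set x | A x \is hermsymmx] =
    [set x | forall i j, (A x j i)^* + -1 * A x i j = 0].
  apply/seteqP; split=> x /=; rewrite hermsymmxE.
    by move=> /eqP h i j; rewrite mulN1r -adjE h subrr.
  move=> h; apply/eqP/matrixP => i j; apply/eqP; rewrite -subr_eq0 adjE -mulN1r.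
  exact/eqP/h.
apply: closed_forall => i; apply: closed_forall => j; apply: closed_ccontinuous_eq0.
apply: ccontinuousD; first exact/ccontinuousJ/cA.
by apply: ccontinuousM; [exact: ccontinuous_cst|exact: cA].
Qed.

Lemma closed_density n (A : X -> 'M[C]_n) :
  mcontinuous A -> closed [set x | density (A x)].
Proof.
move=> cA.
have -> : [set x | density (A x)] = [set x | A x \is hermsymmx] `&`
    [set x | forall v : 'cV[C]_n, 0 <= (v^t* *m A x *m v) ord0 ord0] `&`
    [set x | \sum_i A x i i + -1 = 0].
  apply/seteqP; split=> x /=.
    by move=> [[hA pA] tA]; split=> //; rewrite -/(\tr _) tA subrr.
  by move=> [[hA pA] /eqP]; rewrite subr_eq0 => /eqP tA; split.
apply: closedI; first (apply: closedI; first exact: closed_hermsymmx).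
  apply: closed_forall => v; apply: closed_ccontinuous_ge0.
  have h := mcontinuousM (mcontinuousM (mcontinuous_cst (v^t*)) cA) (mcontinuous_cst v).
  exact: h.
apply: closed_ccontinuous_eq0; apply: ccontinuousD; last exact: ccontinuous_cst.
by apply: ccontinuous_sum => i; exact: cA.
Qed.

(** An intersection over test vectors of closed conditions, squared so that each is polynomial in
    the real and imaginary parts of the entries. *)
Lemma closed_opnorm_le1 m n (A : X -> 'M[C]_(m, n)) :
  mcontinuous A -> closed [set x | opnorm (A x) <= 1].
Proof.
move=> cA.
have -> : [set x | opnorm (A x) <= 1] =
    [set x | forall v, vnorm v <= 1 -> vnorm (A x *m v) ^+ 2 <= 1].
  apply/seteqP; split=> x /= h.
    by move=> v v1; rewrite expr_le1 ?vnorm_ge0 //; exact: (opnormP _ _).1 h v v1.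
  by apply/opnormP => v v1; have := h v v1; rewrite expr_le1 ?vnorm_ge0.
apply: closed_forall => v; apply: closed_imply => _.
apply: closed_le_continuous; last exact: continuous_const.
by apply: continuous_sqr_vnorm; apply: mcontinuousM => //; exact: mcontinuous_cst.
Qed.

Lemma closed_lip_le1 dA dB (H : X -> 'M[C]_(dA * dB)) :
  mcontinuous H -> closed [set x | lip (H x) <= 1].
Proof.
move=> cH.
have cK (Y : 'M[C]_(dA * dB)) : mcontinuous (fun x => commutator Y (H x)).
  by apply: mcontinuousB; apply: mcontinuousM => //; exact: mcontinuous_cst.
have -> : [set x | lip (H x) <= 1] =
    [set x | forall A : 'M[C]_dA, opnorm A <= 1 ->
       opnorm (commutator (A *t (1%:M : 'M[C]_dB)) (H x)) <= 1] `&`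
    [set x | forall B : 'M[C]_dB, opnorm B <= 1 ->
       opnorm (commutator ((1%:M : 'M[C]_dA) *t B) (H x)) <= 1].
  by apply/seteqP; split=> x /= /lip_leP.
by apply: closedI; apply: closed_forall => A; apply: closed_imply => _;
  exact: closed_opnorm_le1.
Qed.

End Continuity.

(** * Real coordinates of complex matrices *)

Section Coordinates.
Context {R : realType}.
Local Notation C := R[i].
Local Notation normc := Normc.normc.

Definition cmx n (y : 'I_n * 'I_n * bool -> R) : 'M[C]_n :=
  \matrix_(i, j) Complex (y (i, j, false)) (y (i, j, true)).

Definition cmx_coord n (A : 'M[C]_n) (k : 'I_n * 'I_n * bool) : R :=
  if k.2 then complex.Im (A k.1.1 k.1.2) else complex.Re (A k.1.1 k.1.2).

Lemma cmx_coordK n (A : 'M[C]_n) : cmx (cmx_coord A) = A.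
Proof. by apply/matrixP => i j; rewrite mxE /cmx_coord /=; case: (A i j). Qed.

Lemma normr_coord_le n (y : 'I_n * 'I_n * bool -> R) i j b :
  `|y (i, j, b)| <= normc (cmx y i j).
Proof.
rewrite mxE /= -sqrtr_sqr ler_sqrt ?addr_ge0 ?sqr_ge0 //.
by case: b; rewrite (lerDl, lerDr) sqr_ge0.
Qed.

Lemma mcontinuous_cmx (I : eqType) n (g : 'I_n * 'I_n * bool -> I) :
  mcontinuous (fun x : prod_topology (fun _ : I => R) => cmx (fun k => x (g k))).
Proof.
move=> i j; split.
  apply: eq_continuous (@proj_continuous I (fun=> R) (g (i, j, false))) => x.
  by rewrite mxE.
apply: eq_continuous (@proj_continuous I (fun=> R) (g (i, j, true))) => x.
by rewrite mxE.
Qed.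

End Coordinates.

(** * Attained maxima, witnesses and the final comparison *)

Section Witnesses.
Context {R : realType}.
Local Notation C := R[i].
Local Notation normc := Normc.normc.

Lemma max_sup (S : set R) m : is_max S m -> sup S = m.
Proof.
case=> Sm ub; apply/eqP; rewrite eq_le; apply/andP; split.
  by apply: ge_sup; first exists m.
by apply: ub_le_sup => //; exists m.
Qed.

(** With [A = X^t* *m X], the mean of the diagonal entries [s i] and [s j] dominates the entry, and
    the diagonal sums to 1. *)
Lemma normc_density_le1 n (A : 'M[C]_n) i j : density A -> normc (A i j) <= 1.
Proof.
case=> /psd_factor[X ->] tA.
pose s k := \sum_l normc (X l k) ^+ 2.
have s0 k : 0 <= s k by apply: sumr_ge0 => l _; exact: sqr_ge0.
have ss : \sum_k s k = 1.
  apply: (@complexI R); rewrite -[RHS]tA /mxtrace rmorph_sum; apply: eq_bigr => k _.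
  by rewrite mxE rmorph_sum; apply: eq_bigr => l _; rewrite adjE conjC_mul_normc.
have s1 k : s k <= 1 by rewrite -ss (bigD1 k) //= lerDl sumr_ge0.
rewrite mxE; apply: (le_trans (normc_sum _ _ _)).
apply: (@le_trans _ _ (\sum_l (normc (X l i) ^+ 2 + normc (X l j) ^+ 2) / 2)).
  apply: ler_sum => l _; rewrite adjE Normc.normcM normcJ.
  have := sqr_ge0 (normc (X l i) - normc (X l j)); nra.
rewrite -mulr_suml big_split /= ler_pdivrMr //.
by have := s1 i; have := s1 j; rewrite /s; lra.
Qed.

Section Bipartite.
Variables dA dB : nat.
Hypotheses (dA0 : (0 < dA)%N) (dB0 : (0 < dB)%N).
Local Notation opAB := 'M[C]_(dA * dB).

Lemma separable_tens (A : 'M[C]_dA) (B : 'M[C]_dB) :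
  density A -> density B -> separable (A *t B).
Proof.
move=> hA hB; exists 1%N, (fun=> 1), (fun=> A), (fun=> B); split=> //.
  by rewrite big_ord1.
by rewrite big_ord1 scale1r.
Qed.

Lemma separable_density (s : opAB) : separable s -> density s.
Proof.
case=> n [p] [sA] [sB] [p0 p1 hs ->].
split.
  apply: psd_sum => k; have [[pA _] [pB _]] := hs k.
  by apply: psdZ; [exact: p0|exact: psd_tens].
rewrite (big_morph _ (@mxtraceD _ _) (@mxtrace0 _ _)) -(rmorph1 (real_complex R)) -p1 rmorph_sum.
apply: eq_bigr => k _; rewrite mxtraceZ tr_tens.
by have [[_ ->] [_ ->]] := hs k; rewrite !mulr1.
Qed.

(** By linearity a convex combination of product states never beats the best product state, so
    compactness is invoked only for pairs of local densities, whatever the number of terms. *)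
Lemma sep_values_max (H : opAB) : exists m, is_max (sep_values H) m.
Proof.
pose I := ('I_dA * 'I_dA * bool + 'I_dB * 'I_dB * bool)%type.
pose X := prod_topology (fun _ : I => R).
pose sA (x : X) : 'M[C]_dA := cmx (fun k => x (inl k)).
pose sB (x : X) : 'M[C]_dB := cmx (fun k => x (inr k)).
have cA : mcontinuous sA by exact: (mcontinuous_cmx (I := I) inl).
have cB : mcontinuous sB by exact: (mcontinuous_cmx (I := I) inr).
pose D := [set x : X | density (sA x)] `&` [set x | density (sB x)].
pose code (A : 'M[C]_dA) (B : 'M[C]_dB) : X := fun i =>
  match i with inl k => cmx_coord A k | inr k => cmx_coord B k end.
have codeA A B : sA (code A B) = A by exact: cmx_coordK.
have codeB A B : sB (code A B) = B by exact: cmx_coordK.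
have codeD A B : density A -> density B -> D (code A B).
  by move=> hA hB; split=> /=; rewrite (codeA, codeB).
have D0 : D !=set0.
  by eexists; apply: codeD; exact: density_mixed.
have clD : closed D by apply: closedI; exact: closed_density.
have bD x : D x -> forall i, `|x i| <= 1.
  move=> [dA' dB'] [[[i j] b]|[[i j] b]].
    exact: le_trans (normr_coord_le (fun k => x (inl k)) i j b) (normc_density_le1 _ _ dA').
  exact: le_trans (normr_coord_le (fun k => x (inr k)) i j b) (normc_density_le1 _ _ dB').
have cf : continuous (fun x : X => expect H (sA x *t sB x)).
  by apply: continuous_expect; [exact: mcontinuous_cst|exact: mcontinuous_tens].
have [c [cA' cB'] cmax] := compact_max_exists D0 clD bD cf.
exists (expect H (sA c *t sB c)); split.
  by exists (sA c *t sB c) => //; exact: separable_tens.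
move=> _ [_ [n [p [tA [tB [p0 p1 ht ->]]]]] <-].
rewrite expect_sumr -[leRHS]mul1r -p1 mulr_suml; apply: ler_sum => k _.
rewrite expectZr ler_wpM2l //; have [hA hB] := ht k.
by have := cmax _ (codeD _ _ hA hB); rewrite codeA codeB.
Qed.

Lemma alpha_max (H : opAB) : is_max (sep_values H) (alpha H).
Proof. by have [m hm] := sep_values_max H; rewrite /alpha (max_sup hm). Qed.

Lemma expect_le_alpha (H s : opAB) : separable s -> expect H s <= alpha H.
Proof. by move=> hs; apply: (alpha_max H).2; exists s. Qed.

Variable rho : opAB.
Hypothesis drho : density rho.

Lemma expect_sub_alpha_le1 (H : opAB) : lip H <= 1 -> expect H rho - alpha H <= 1.
Proof.
move=> lH; apply: le_trans (twirl_cost drho lH); rewrite lerD2l lerN2.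
apply: expect_le_alpha; apply: separable_tens; first exact: density_mixed.
exact: density_ptrace1.
Qed.

Definition lip_values : set R := [set expect H rho - alpha H |
  H in [set H : opAB | H \is hermsymmx /\ lip H <= 1]].

Lemma witness_values : [set - expect W rho | W in @witness R dA dB] = lip_values.
Proof.
apply/seteqP; split=> [_ [W [hW W0 [W1 _] lW] <-]|_ [H [hH lH] <-]].
  exists (- W).
    split; first by move: hW; rewrite !hermsymmxE adjN eqr_opp.
    by rewrite -sub0r -(raddf0 (@scalar_mx C (dA * dB))); exact: lip_scalarB.
  (* Nonnegativity on separable states gives only [<= 0]; equality is the requirement that the
     minimum 0 be attained. *)
  have -> : alpha (- W) = 0.
    apply: max_sup; split; last first.
      by move=> _ [s hs <-]; rewrite expectNl oppr_le0; exact: W0.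
    by case: W1 => s hs Ws; exists s => //; rewrite expectNl Ws oppr0.
  by rewrite expectNl subr0.
exists ((alpha H)%:C%C%:M - H).
  have sepE s : separable s -> expect ((alpha H)%:C%C%:M - H) s = alpha H - expect H s.
    by move=> /separable_density[_ ts]; rewrite expectDl expectNl expect_scalar.
  have W0 s : separable s -> 0 <= expect ((alpha H)%:C%C%:M - H) s.
    by move=> hs; rewrite sepE // subr_ge0 expect_le_alpha.
  split; [|exact: W0| |exact: lip_scalarB].
    move: hH; rewrite !hermsymmxE adjD adjN => /eqP ->.
    by rewrite -scalemx1 adj_real_scale adj1.
  split; last by move=> _ [s hs <-]; exact: W0.
  (* The separable state maximising [H] is where the witness vanishes. *)
  by have [[s hs es] _] := alpha_max H; exists s; rewrite ?sepE ?es ?subrr.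
by rewrite expectDl expectNl (expect_scalar _ drho.2) opprB.
Qed.

(* The supremum is the largest t such that (H, t) lies in a set cut out by
   closed conditions, H being normalised by the vanishing of one diagonal
   entry; the Lipschitz condition then bounds all entries. *)
Lemma lip_values_max : exists m, is_max lip_values m.
Proof.
have N0 : (0 < dA * dB)%N by rewrite muln_gt0 dA0.
pose x0 := Ordinal N0.
pose I := option ('I_(dA * dB) * 'I_(dA * dB) * bool).
pose X := prod_topology (fun _ : I => R).
pose mx (x : X) : opAB := cmx (fun k => x (Some k)).
have cmx' : mcontinuous mx by exact: (mcontinuous_cmx (I := I) Some).
have ct : continuous (fun x : X => x None) by exact: (@proj_continuous I (fun=> R)).
(* The coordinate [None] holds [t]. Requiring [0 <= t] bounds it below and costs nothing, since
   [H = 0] has value 0. *)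
pose D := ([set x : X | mx x \is hermsymmx] `&` [set x | lip (mx x) <= 1] `&`
  [set x | mx x x0 x0 = 0] `&` [set x | 0 <= x None]) `&`
  [set x | forall s, separable s -> x None <= expect (mx x) rho - expect (mx x) s].
pose code (A : opAB) (t : R) : X := fun i =>
  match i with Some k => cmx_coord A k | None => t end.
have codeE A t : mx (code A t) = A by exact: cmx_coordK.
have comm0 Y : opnorm (commutator Y (0 : opAB)) <= 1.
  by apply: opnorm_le => v _; rewrite /commutator mulmx0 mul0mx subr0 mul0mx vnorm0.
have herm0 : (0 : opAB) \is hermsymmx by rewrite hermsymmxE trmx0 map_mx0.
have lip0 : lip (0 : opAB) <= 1 by apply/lip_leP; split=> Y _; exact: comm0.
have expect0 s : expect (0 : opAB) s = 0 by rewrite /expect mul0mx mxtrace0.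
have D0 : D !=set0.
  exists (code 0 0); rewrite /D /= !codeE; split; last by move=> s _; rewrite !expect0 subrr.
  by rewrite mxE; do 3 (split; last by []).
have clD : closed D.
  apply: closedI; [apply: closedI; [apply: closedI; [apply: closedI|]|]|].
  - exact: closed_hermsymmx.
  - exact: closed_lip_le1.
  - exact/closed_ccontinuous_eq0/cmx'.
  - by apply: closed_le_continuous => //; exact: continuous_const.
  apply: closed_forall => s; apply: closed_imply => _; apply: closed_le_continuous => //.
  by apply: continuous_sub; apply: continuous_expect => //; exact: mcontinuous_cst.
have le_val x : D x -> x None <= expect (mx x) rho - alpha (mx x).
  by move=> [_ h]; have [[s hs <-] _] := alpha_max (mx x); exact: h.
have bD x : D x -> forall i, `|x i| <= 2.
  move=> Dx; have lv := le_val _ Dx; case: Dx => -[[[hx lx] x00] xN] _ [[[i j] b]|].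
    apply: (le_trans (normr_coord_le (fun k => x (Some k)) i j b)).
    by have := lip_entry_bound x0 i j lx; rewrite x00 mulr0 subr0.
  rewrite ger0_norm // (le_trans lv) // (le_trans (expect_sub_alpha_le1 lx)) //.
  by rewrite ler1n.
have [c Dc cmax] := compact_max_exists D0 clD bD ct.
exists (expect (mx c) rho - alpha (mx c)); split.
  by case: Dc => -[[[hx lx] _] _] _; exists (mx c); [split|].
move=> _ [H [hH lH] <-].
have c0 : 0 <= c None by case: Dc => -[_ cN] _.
apply: le_trans (le_val _ Dc).
have [H0|/ltW H0] := lerP 0 (expect H rho - alpha H); last exact: le_trans H0 c0.
have [a Ha] : exists a : R, H x0 x0 = a%:C%C.
  exists (complex.Re (H x0 x0)); move: hH; rewrite hermsymmxE => /eqP/matrixP/(_ x0 x0).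
  rewrite adjE; case: (H x0 x0) => u v; rewrite conjCc => -[/eqP].
  by rewrite eq_sym -addr_eq0 -mulr2n mulrn_eq0 /= => /eqP ->.
(* This is [H - a], written as two subtractions from a scalar to suit [lip_scalarB]. *)
pose H' : opAB := 0%:M - (a%:C%C%:M - H).
have lH' : lip H' <= 1 by do 2 apply: lip_scalarB.
have eH' s : \tr s = 1 -> expect H' s = expect H s - a.
  move=> ts; rewrite /H' (raddf0 (@scalar_mx C (dA * dB))) sub0r opprB expectDl expectNl.
  by rewrite expect_scalar.
suff DH : D (code H' (expect H rho - alpha H)) by exact: (cmax _ DH).
rewrite /D /= !codeE; split; [split; [split; [split; [|exact: lH']|]|exact: H0]|].
- rewrite /H' (raddf0 (@scalar_mx C (dA * dB))) sub0r opprB.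
  move: hH; rewrite !hermsymmxE adjD adjN => /eqP ->.
  by rewrite -scalemx1 adj_real_scale adj1.
- by rewrite /H' !mxE eqxx Ha !mulr1n subrr subr0.
move=> s hs; rewrite !eH'; [|exact: (separable_density hs).2|exact: drho.2].
by rewrite opprB addrA subrK lerD2l lerN2 expect_le_alpha.
Qed.

Lemma wit_max : is_max lip_values (wit rho).
Proof.
by have [m hm] := lip_values_max; rewrite /wit witness_values (max_sup hm).
Qed.

Lemma wit_le1 : wit rho <= 1.
Proof. by have [[H [_ lH] <-] _] := wit_max; exact: expect_sub_alpha_le1. Qed.

Lemma wit_separable_le0 : separable rho -> wit rho <= 0.
Proof.
by move=> srho; have [[H _ <-] _] := wit_max; rewrite subr_le0 expect_le_alpha.
Qed.

Lemma coupling_tens (s : opAB) : density s -> coupling rho s (rho *t s).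
Proof.
move=> ds; split; first exact: density_tens.
  by rewrite ptrace2_tens ds.2 scale1r.
by rewrite ptrace1_tens drho.2 scale1r.
Qed.

Lemma separable_neq0 : @separable R dA dB !=set0.
Proof. by eexists; apply: separable_tens; exact: density_mixed. Qed.

Lemma wit_le_entanglement (FA : 'I_(dA ^ 2 - 1) -> 'M[C]_dA)
    (FB : 'I_(dB ^ 2 - 1) -> 'M[C]_dB) :
  observable_family FA -> observable_family FB ->
  wit rho <= entanglement FA FB rho.
Proof.
move=> hA hB; apply: lb_le_inf.
  by have [s hs] := separable_neq0; exists (wasserstein1 FA FB rho s); exists s.
move=> _ [s hs <-].
(* In dimension one there are no observables and the cost is 0, so the bound by 1 is too weak;
   [wit rho <= 0] replaces it. *)
have [/andP[/eqP eA /eqP eB]|d3] := boolP ((dA == 1) && (dB == 1))%N.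
  apply: le_trans (sqrtr_ge0 _); apply: wit_separable_le0.
  (* Generalising the dimension allows [n] to be replaced by 1 inside the matrix type. *)
  have one (n : nat) : n = 1%N -> forall A : 'M[C]_n, \tr A = 1 -> A = 1%:M.
    move=> -> A; rewrite /mxtrace big_ord1 => A1.
    by apply/matrixP => i j; rewrite !ord1 A1 mxE eqxx.
  have -> : rho = 1%:M by apply: one drho.2; rewrite eA eB.
  rewrite -tens1mx1.
  have dens1 n : n = 1%N -> density (1%:M : 'M[C]_n).
    by move=> ->; have := @density_mixed R 1 isT; rewrite invr1 scale1r.
  by apply: separable_tens; [exact: dens1 eA|exact: dens1 eB].
apply: (le_trans wit_le1); rewrite -[leLHS]sqrtr1; apply: ler_wsqrtr.
apply: lb_le_inf.
  (* The product coupling makes the set nonempty; the default [inf] of the empty set would be 0. *)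
  by exists (expect (cost FA FB) (rho *t s)); exists (rho *t s) => //;
    apply: coupling_tens; exact: separable_density.
move=> _ [T [dT _ _] <-]; apply: le_trans (expect_cost_ge hA hB dT).
(* Then [2 (dA - 1) + 2 (dB - 1)] is at least 2, which exceeds the required 1. *)
have : (3 <= dA + dB)%N by lia.
by rewrite -(ler_nat R) natrD; lra.
Qed.

End Bipartite.
End Witnesses.

Theorem proposition10 (R : realType) (dA dB : nat)
    (FA : 'I_(dA ^ 2 - 1) -> 'M[R[i]]_dA)
    (FB : 'I_(dB ^ 2 - 1) -> 'M[R[i]]_dB)
    (hFA : observable_family FA) (hFB : observable_family FB)
    (rho : 'M[R[i]]_(dA * dB)) (hrho : density rho) :
  [/\ forall H : 'M[R[i]]_(dA * dB), H \is hermsymmx ->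
        is_max (sep_values H) (alpha H),
      is_max [set expect H rho - alpha H |
               H in [set H : 'M[R[i]]_(dA * dB) | H \is hermsymmx /\ lip H <= 1]]
             (wit rho)
    & wit rho <= entanglement FA FB rho].
Proof.
(* An empty matrix has trace 0, so a density forces positive dimensions. *)
have /andP[dA0 dB0] : (0 < dA)%N && (0 < dB)%N.
  by rewrite -muln_gt0; exact: density_gt0 hrho.
split; first by move=> H _; exact: alpha_max.
- exact: wit_max.
- exact: wit_le_entanglement.
Qed.
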